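(* Let $\mathcal{M}$ be an MDP with integer weights and designated absorbing state $\mathit{goal}$. If $\mathit{CE}^{\sup}_{s_{\mathit{init}}}$ is finite in $\mathcal{M}$, then there is a weight-based deterministic scheduler $\mathfrak{S}$ with $\mathit{CE}^{\sup}_{s_{\mathit{init}}}=\mathit{CE}^{\mathfrak{S}}_{s_{\mathit{init}}}$.
   Context: A Markov decision process (MDP) is a tuple $\mathcal{M}=(S,\mathit{Act},P,s_{\mathit{init}},\mathit{wgt})$ with finite state set $S$, finite action set $\mathit{Act}$, initial state $s_{\mathit{init}}$, $P:S\times\mathit{Act}\times S\to[0,1]\cap\mathbb{Q}$ with $\sum_{t}P(s,\alpha,t)\in\{0,1\}$, and $\mathit{wgt}:S\times\mathit{Act}\to\mathbb{Z}$. $\mathit{Act}(s)$ is the (nonempty) set of actions $\alpha$ enabled in $s$, i.e. with $\sum_tP(s,\alpha,t)=1$. All states are assumed reachable from $s_{\mathit{init}}$. A state is absorbing if its only enabled action leads back to it with probability $1$ and weight $0$. For a finite path $\pi$ (alternating sequence of states and actions with positive transition probabilities), $\mathit{wgt}(\pi)$ is the sum of the weights of its steps and $\mathit{last}(\pi)$ its last state. A scheduler assigns to every finite path $\pi$ a probability distribution on $\mathit{Act}(\mathit{last}(\pi))$; it is deterministic if all these distributions are Dirac, and weight-based if its choice after $\pi$ depends only on $(\mathit{last}(\pi),\mathit{wgt}(\pi))$. $\Pr^{\mathfrak{S}}_s$, $\mathbb{E}^{\mathfrak{S}}_s$ denote the induced measure on infinite paths from $s$ and its expectation; $\Diamond\mathit{goal}$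 is the event of reaching $\mathit{goal}$. Standing assumption: there is a designated absorbing state $\mathit{goal}$, and all states from which $\mathit{goal}$ is not reachable are collapsed to one absorbing state $\mathit{fail}$. The random variable $\oplus^0\mathit{goal}$ has as value the weight accumulated until $\mathit{goal}$ on infinite paths reaching $\mathit{goal}$ and $0$ on all other paths. $\mathit{CE}^{\mathfrak{S}}_{s_{\mathit{init}}}=\mathbb{E}^{\mathfrak{S}}_{s_{\mathit{init}}}(\oplus^0\mathit{goal}\mid\Diamond\mathit{goal})$, defined if $\Pr^{\mathfrak{S}}_{s_{\mathit{init}}}(\Diamond\mathit{goal})>0$, and $\mathit{CE}^{\sup}_{s_{\mathit{init}}}$ is the supremum over all (history-dependent, randomized) schedulers with $\Pr^{\mathfrak{S}}_{s_{\mathit{init}}}(\Diamond\mathit{goal})>0$. *)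

(* Defs.v *)
From HB Require Import structures.
From mathcomp Require Import all_boot all_order all_algebra.
From mathcomp Require Import all_classical all_reals all_analysis.
From mathcomp Require Import lra.

Set Implicit Arguments.
Unset Strict Implicit.
Unset Printing Implicit Defensive.

Import Order.TTheory GRing.Theory Num.Theory.

Local Open Scope classical_set_scope.
Local Open Scope ring_scope.

Definition edge (S Act : finType) (P : S -> Act -> S -> rat) : rel S :=
  fun s t => [exists a, 0 < P s a t].

Record mdp (S Act : finType) := MDP {
  tr : S -> Act -> S -> rat;
  init : S;
  wgt : S -> Act -> int;
  tr_itv : forall s a t, 0 <= tr s a t <= 1;
  tr_sum : forall s a, \sum_t tr s a t = 0 \/ \sum_t tr s a t = 1;
  tr_enabled : forall s, exists a, \sum_t tr s a t = 1;
  tr_reachable : forall s, connect (edge tr) init s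
}.

Section Models.
Variables S Act : finType.
Implicit Types (M : mdp S Act) (s t : S) (a b : Act).

Definition enabled M s : {set Act} := [set a | \sum_t tr M s a t == 1].

Definition reachable M : rel S := connect (edge (tr M)).

Definition absorbing M s : Prop :=
  exists a, [/\ enabled M s = [set a]%SET, tr M s a s = 1 & wgt M s a = 0].

(* There may be no state at all from which goal is unreachable. *)
Definition fail_collapsed M (goal : S) : Prop :=
  (forall s, ~~ reachable M s goal -> absorbing M s) /\
  (forall s t, ~~ reachable M s goal -> ~~ reachable M t goal -> s = t).

(* (s0, [:: (a0, s1); (a1, s2); ...]) encodes s0 a0 s1 a1 s2 ...;
   [is_path] selects the sequences that are paths of the MDP. *)
Definition fin_path : Type := (S * seq (Act * S))%type.

Definition last_st (p : fin_path) : S := last p.1 (unzip2 p.2).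

Fixpoint steps_ok M s (h : seq (Act * S)) : bool :=
  if h is (a, t) :: h' then (0 < tr M s a t) && steps_ok M t h' else true.

Definition is_path M (p : fin_path) : bool := steps_ok M p.1 p.2.

Fixpoint steps_wgt M s (h : seq (Act * S)) : int :=
  if h is (a, t) :: h' then wgt M s a + steps_wgt M t h' else 0.

Definition path_wgt M (p : fin_path) : int := steps_wgt M p.1 p.2.

Definition extend (p : fin_path) (x : Act * S) : fin_path :=
  (p.1, rcons p.2 x).

(* The values on sequences that are not paths are irrelevant. *)
Record scheduler (R : realType) M := Scheduler {
  sched :> fin_path -> Act -> R;
  sched_ge0 : forall p, is_path M p -> forall a, 0 <= sched p a;
  sched_sum : forall p, is_path M p -> \sum_a sched p a = 1;
  sched_enabled : forall p, is_path M p ->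
    forall a, a \notin enabled M (last_st p) -> sched p a = 0
}.

Definition deterministic R M (sigma : scheduler R M) : Prop :=
  forall p, is_path M p -> exists a, forall b, sigma p b = (b == a)%:R.

Definition weight_based R M (sigma : scheduler R M) : Prop :=
  forall p q, is_path M p -> is_path M q ->
    last_st p = last_st q -> path_wgt M p = path_wgt M q -> sigma p = sigma q.

(* Sample space: all state-action sequences; those using a transition of
   probability 0 form a null set for the measures below.  M is an argument
   only because it provides the default point. *)
Definition inf_path M : Type := (S * (nat -> Act * S))%type.

Fact inf_path_pointed M : inf_path M.
Proof.
have [a _] := cid (tr_enabled M (init M)).
exact: (init M, fun=> (a, init M)).
Qed.

HB.instance Definition _ M := gen_eqMixin (inf_path M).
HB.instance Definition _ M := gen_choiceMixin (inf_path M).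
HB.instance Definition _ M := isPointed.Build (inf_path M) (inf_path_pointed M).

Definition prefix (w : S * (nat -> Act * S)) (n : nat) : fin_path :=
  (w.1, mkseq w.2 n).

Definition cylinder M (p : fin_path) : set (inf_path M) :=
  [set w | prefix w (size p.2) = p].

Definition runs M := g_sigma_algebraType (range (@cylinder M)).

(* [steps_prob sigma p h]: probability that the steps h follow p. *)
Fixpoint steps_prob R M (sigma : scheduler R M) (p : fin_path)
    (h : seq (Act * S)) : R :=
  if h is x :: h' then
    sigma p x.1 * ratr (tr M (last_st p) x.1 x.2) *
    steps_prob sigma (extend p x) h'
  else 1.

Definition path_prob R M (sigma : scheduler R M) s (p : fin_path) : R :=
  (p.1 == s)%:R * steps_prob sigma (s, [::]) p.2.

End Models.
Arguments cylinder {S Act} M p.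

(* Existence of the law of a random infinite word over a finite alphabet with
   prescribed prefix probabilities q, as the image of the uniform law on [0, 1[
   under successive subdivision; mk encodes words as points of T, and G plays
   the role of the cylinders. *)
Section RandomWord.
Variables (R : realType) (X : finType) (x0 : X) (q : seq X -> R).
Hypothesis q_nil : q [::] = 1.
Hypothesis q_ge0 : forall h, 0 <= q h.
Hypothesis q_rcons : forall h, \sum_x q (rcons h x) = q h.

Let offs (g : X -> R) (s : seq X) (x : X) : R :=
  \sum_(y <- take (index x s) s) g y.

Let offs_cons g y s x : x != y -> offs g (y :: s) x = g y + offs g s x.
Proof.
by move=> xy; rewrite /offs /= eq_sym (negPf xy) /= big_cons.
Qed.

Let offs_hd g x s : offs g (x :: s) x = 0.
Proof. by rewrite /offs /= eqxx big_nil. Qed.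

Let offs_ge0 g s x : (forall y, 0 <= g y) -> 0 <= offs g s x.
Proof. by move=> g0; apply: sumr_ge0. Qed.

Let offs_le g s x : (forall y, 0 <= g y) -> x \in s ->
  offs g s x + g x <= \sum_(y <- s) g y.
Proof.
move=> g0; elim: s => // y s IH; rewrite inE big_cons.
case: (eqVneq x y) => [-> _|xy /= xs].
  by rewrite offs_hd add0r lerDl sumr_ge0.
by rewrite offs_cons // -addrA lerD2l IH.
Qed.

Let offs_ex g s v : (forall y, 0 <= g y) -> uniq s ->
  0 <= v < \sum_(y <- s) g y ->
  exists2 x, x \in s & offs g s x <= v < offs g s x + g x.
Proof.
move=> g0; elim: s v => [|y s IH] v; first by rewrite big_nil; lra.
rewrite big_cons /= => /andP[ys us] /andP[v0 vs].
have [vy|yv] := ltP v (g y).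
  by exists y; rewrite ?mem_head // offs_hd add0r v0 vy.
have [||x xs /andP[x1 x2]] := IH (v - g y) => //; first by lra.
have xy : x != y by apply: contraNneq ys => <-.
by exists x; rewrite ?inE ?xs ?orbT // offs_cons //; lra.
Qed.

Let offs_uniq g s v x y : (forall y, 0 <= g y) -> x \in s -> y \in s ->
  offs g s x <= v < offs g s x + g x ->
  offs g s y <= v < offs g s y + g y -> x = y.
Proof.
move=> g0; elim: s v => // z s IH v; rewrite !inE.
case: (eqVneq x z) => [->|xz] /=; case: (eqVneq y z) => [->|yz] //=.
- move=> _ _; rewrite offs_hd offs_cons //.
  by have := offs_ge0 s y g0 => *; exfalso; lra.
- move=> _ _; rewrite offs_hd offs_cons //.
  by have := offs_ge0 s x g0 => *; exfalso; lra.
- move=> xs ys; rewrite !offs_cons // => ? ?.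
  by apply: (IH (v - g z)) => //; lra.
Qed.

Let off h x := offs (fun y => q (rcons h y)) (enum X) x.

Let next h v := odflt x0 [pick x | off h x <= v < off h x + q (rcons h x)].

Let nextP h v : 0 <= v < q h ->
  forall x, next h v = x <-> off h x <= v < off h x + q (rcons h x).
Proof.
move=> vq; rewrite /next; case: pickP => [y yP|noy] x /=.
  split=> [<- //|xP].
  by apply: (offs_uniq (g := fun y => q (rcons h y)) _ _ _ yP xP); rewrite ?mem_enum.
have [||x' _] := @offs_ex (fun y => q (rcons h y)) (enum X) v _ (enum_uniq X) => //.
  by rewrite big_enum /= q_rcons.
by move=> x'P; have := noy x'; rewrite /off x'P.
Qed.

Let lo h := \sum_(i < size h) off (take i h) (nth x0 h i).

Let lo_rcons h x : lo (rcons h x) = lo h + off h x.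
Proof.
rewrite /lo size_rcons big_ord_recr /= nth_rcons ltnn eqxx -cats1 take_size_cat //.
congr (_ + _); apply: eq_bigr => i _.
by rewrite takel_cat ?(ltnW (ltn_ord i)) // nth_cat ltn_ord.
Qed.

Let off_le h x : off h x + q (rcons h x) <= q h.
Proof.
have := @offs_le (fun y => q (rcons h y)) (enum X) x.
by rewrite big_enum /= q_rcons; apply; rewrite ?mem_enum.
Qed.

Let lo_itv h : 0 <= lo h /\ lo h + q h <= 1.
Proof.
elim/last_ind: h => [|h x IH]; first by rewrite /lo big_ord0 q_nil; lra.
have off0 : 0 <= off h x by apply: offs_ge0.
by rewrite lo_rcons; have := off_le h x; lra.
Qed.

Let word u := fix word n : seq X :=
  if n is n'.+1 then rcons (word n') (next (word n') (u - lo (word n')))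
  else [::].

Let letter u n := next (word u n) (u - lo (word u n)).

Let mkseq_letter u n : mkseq (letter u) n = word u n.
Proof. by elim: n => // n IH; rewrite mkseqS IH. Qed.

Let wordP u : 0 <= u < 1 ->
  forall h, word u (size h) = h <-> lo h <= u < lo h + q h.
Proof.
move=> u01; elim/last_ind => [|h x IH].
  by rewrite /lo /= big_ord0 q_nil add0r u01.
have off0 : 0 <= off h x by apply: offs_ge0.
have offq := off_le h x.
rewrite size_rcons /= lo_rcons; split.
  move=> /rcons_inj[hE]; rewrite hE => xE; move/IH: hE => uh.
  have : off h x <= u - lo h < off h x + q (rcons h x) by apply/nextP => //; lra.
  lra.
move=> uP; have uh : lo h <= u < lo h + q h by lra.
move/IH: (uh) => ->; congr rcons; apply/nextP; lra.
Qed.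

Lemma random_word (T : pointedType) (G : set (set T))
    (mk : (nat -> X) -> T) :
  (forall A, G A -> (exists h, forall f, A (mk f) <-> mkseq f (size h) = h) \/
                    (forall f, ~ A (mk f))) ->
  exists P : probability (g_sigma_algebraType G) R,
    (forall A h, G A -> (forall f, A (mk f) <-> mkseq f (size h) = h) ->
        P A = (q h)%:E) /\
    (forall A, G A -> (forall f, ~ A (mk f)) -> P A = 0%E).
Proof.
move=> GP.
pose D : set (measurableTypeR R) := `[0, 1[%classic.
pose clip (u : R) : R := if 0 <= u < 1 then u else 0.
pose F (u : measurableTypeR R) : g_sigma_algebraType G := mk (letter (clip u)).
have clipD u : 0 <= clip u < 1 by rewrite /clip; case: ifP => // _; lra.
have mD : measurable D by exact: measurable_itv.
have DF A h : (forall f, A (mk f) <-> mkseq f (size h) = h) ->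
    F @^-1` A `&` D = `[lo h, lo h + q h[ `&` D.
  move=> Ah; apply/seteqP; split=> u /= [uA uD]; split=> //.
    move: uA; rewrite /F Ah mkseq_letter wordP //.
    by move: uD; rewrite /D /= in_itv /= /clip => ->; rewrite in_itv.
  rewrite /F; apply/Ah; rewrite mkseq_letter; apply/wordP => //.
  by move: uD uA; rewrite /D /= in_itv /= /clip => ->; rewrite in_itv.
have mF : measurable_fun setT F.
  apply: (@measurability _ _ _ _ setT F G) => [//|_ [A GA <-]]; rewrite setTI.
  rewrite -(setUIDK (F @^-1` A) D); apply: measurableU.
    have [[h Ah]|An] := GP A GA.
      by rewrite (DF _ _ Ah); apply: measurableI => //; exact: measurable_itv.
    rewrite (_ : _ `&` _ = set0) //; apply/seteqP; split=> u //= [].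
    by rewrite /F => /An.
  have [A0|A0] := pselect (A (F 1)).
    rewrite (_ : _ `\` _ = ~` D); first exact: measurableC.
    apply/seteqP; split=> u /=; first by case.
    move=> uD; split=> //; move: uD A0; rewrite /D /= in_itv /= => /negP/negPf uD.
    by rewrite /F /clip uD ltxx andbF.
  rewrite (_ : _ `\` _ = set0) //; apply/seteqP; split=> u //= [].
  rewrite /D /= in_itv /= => uA /negP/negPf uD; apply: A0.
  by move: uA; rewrite /F /clip uD ltxx andbF.
pose mF' : {mfun _ >-> _} := HB.pack F (isMeasurableFun.Build _ _ _ _ F mF).
have D1 : mrestr (@lebesgue_measure R) mD setT = 1%E.
  by rewrite /mrestr setTI /D lebesgue_measure_itv /= lte_fin ltr01 sube0.
pose U : probability (measurableTypeR R) R := HB.pack (mrestr (@lebesgue_measure R) mD)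
  (Measure_isProbability.Build _ _ _ (mrestr (@lebesgue_measure R) mD) D1).
exists (distribution U mF'); split=> [A h GA Ah|A GA An].
  rewrite /distribution /pushforward /= /mrestr /= (DF _ _ Ah) setIidl; last first.
    move=> u /=; rewrite /D /= !in_itv /=.
    by have := lo_itv h; lra.
  rewrite lebesgue_measure_itv /= lte_fin.
  case: ifPn => [_|]; first by rewrite -EFinB addrAC subrr add0r.
  by rewrite -leNgt gerDl => qh; congr EFin; apply/esym/le_anti; rewrite qh q_ge0.
rewrite /distribution /pushforward /= /mrestr /=.
rewrite (_ : F @^-1` A = set0) ?set0I ?measure0 //.
by apply/seteqP; split=> u //= /An.
Qed.
End RandomWord.


Section PathMeasure.
Variables (R : realType) (S Act : finType) (M : mdp S Act).
Variables (sigma : scheduler R M).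

Lemma is_path_extend (p : fin_path S Act) (x : Act * S) :
  is_path M (extend p x) = is_path M p && (0 < tr M (last_st p) x.1 x.2).
Proof.
case: p x => s h [a t]; rewrite /is_path /last_st /=.
elim: h s => [|[b u] h IH] s /=; first by rewrite andbT.
by rewrite IH andbA.
Qed.

Lemma tr_gt0 s a t : tr M s a t != 0 -> 0 < tr M s a t.
Proof. by move=> n0; rewrite lt_def n0; case/andP: (tr_itv M s a t). Qed.

Lemma steps_prob_ge0 p h : is_path M p -> 0 <= steps_prob sigma p h.
Proof.
elim: h p => [|[a t] h IH] p pP //=.
have [->|/tr_gt0 tr0] := eqVneq (tr M (last_st p) a t) 0.
  by rewrite raddf0 mulr0 mul0r.
apply: mulr_ge0; last by apply: IH; rewrite is_path_extend pP.
by rewrite mulr_ge0 ?sched_ge0 // ler0q ltW.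
Qed.

Lemma steps_prob_rcons p h : is_path M p ->
  \sum_x steps_prob sigma p (rcons h x) = steps_prob sigma p h.
Proof.
elim: h p => [|[a t] h IH] p pP /=.
  under eq_bigr do rewrite mulr1.
  rewrite -(pair_bigA _ (fun a t => sigma p a * ratr (tr M (last_st p) a t))) /=.
  rewrite -(sched_sum sigma pP); apply: eq_bigr => a _.
  rewrite -mulr_sumr -raddf_sum /=.
  have [aE|aN] := boolP (a \in enabled M (last_st p)).
    by move: aE; rewrite inE => /eqP ->; rewrite rmorph1 mulr1.
  by rewrite (sched_enabled sigma pP aN) mul0r.
rewrite -mulr_sumr; have [->|/tr_gt0 tr0] := eqVneq (tr M (last_st p) a t) 0.
  by rewrite raddf0 mulr0 !mul0r.
by rewrite IH // is_path_extend pP.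
Qed.

Lemma path_measure_exists (s : S) :
  exists P : probability (runs M) R,
    forall p, P (cylinder M p) = (path_prob sigma s p)%:E.
Proof.
have [a0 _] := tr_enabled M s.
have sP : is_path M (s, [::]) by [].
have [||||P [P1 P2]] := @random_word R (Act * S)%type (a0, s)
  (steps_prob sigma (s, [::])) _ _ _ _ (range (cylinder M)) (pair s) => //.
- by move=> h; apply: steps_prob_ge0.
- by move=> h; apply: steps_prob_rcons.
- move=> _ [[t h] _ <-]; have [->|ts] := eqVneq t s.
    by left; exists h => f; rewrite /cylinder /prefix /=; split=> [[]//|->].
  by right=> f; rewrite /cylinder /prefix /= => -[/esym/eqP]; rewrite (negPf ts).
exists P => -[t h]; rewrite /path_prob /=.
have Gth : range (cylinder M) (cylinder M (t, h)) by exists (t, h).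
have [ts|ts] := eqVneq t s.
  rewrite mul1r; apply: P1 => // f; rewrite ts /cylinder /prefix /=.
  by split=> [[]//|->].
rewrite mul0r; apply: P2 => // f; rewrite /cylinder /prefix /=.
by move=> [/esym/eqP]; rewrite (negPf ts).
Qed.

(* By the pi-lambda theorem, [Pr_cylinder] determines Pr s. *)
Definition Pr (s : S) : probability (runs M) R :=
  sval (cid (path_measure_exists s)).

Lemma Pr_cylinder s p : Pr s (cylinder M p) = (path_prob sigma s p)%:E.
Proof. exact: (svalP (cid (path_measure_exists s))). Qed.

End PathMeasure.

Section ConditionalExpectation.
Variables (R : realType) (S Act : finType) (M : mdp S Act) (goal : S).

Definition hits (w : runs M) : pred nat :=
  fun n => last_st (prefix w n) == goal.

Definition reach : set (runs M) := [set w | exists n, hits w n].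

Definition acc_wgt (w : runs M) : R :=
  if pselect (exists n, hits w n) is left h
  then (path_wgt M (prefix w (ex_minn h)))%:~R
  else 0.

(* The integral is -oo when the positive and negative parts of X are both
   non-integrable on A, so that such cases do not contribute to suprema. *)
Definition cond_expectation d (T : measurableType d) (P : probability T R)
    (X : T -> R) (A : set T) : \bar R :=
  ((\int[P]_(w in A) (X w)%:E) / P A)%E.

Definition CE (sigma : scheduler R M) : \bar R :=
  cond_expectation (Pr sigma (init M)) acc_wgt reach.

Definition CE_sup : \bar R :=
  ereal_sup [set CE sigma | sigma in
    [set sigma | (0 < Pr sigma (init M) reach)%E]].

End ConditionalExpectation.
Arguments hits {S Act} M goal w.
Arguments reach {S Act} M goal.
Arguments acc_wgt R {S Act} M goal w.
Arguments CE_sup R {S Act} M goal.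

(* Main.v *)
(* Let theta be the supremum, and let V s y be the optimal expectation of
   W - theta on the runs reaching the goal (0 on the others), from s with current
   weight y + theta.  Then V (init, - theta) = 0, and the optimal scheduler takes
   actions that conserve V and, where possible, bring the goal closer within the
   graph of conserving actions.

   Finiteness of theta forbids climbing to arbitrarily high weights while keeping
   the choice of avoiding the goal.  This yields a Lyapunov function L of
   exponential growth in the weight, superharmonic for all schedulers, against
   which V is negligible outside bounded weights.  In particular V vanishes where
   no conserving path leads to the goal.  Under the above scheduler V is a
   martingale, and the part of its expectation carried by the runs still off the
   goal tends to 0: on bounded weights the goal is reached with a probability
   bounded below, and elsewhere L dominates.  So the expectation of W - theta is 0.

   The goal must moreover be reachable from (init, - theta) by conserving
   actions.  Otherwise all other actions at states reached this way lose at least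
   some delta > 0 uniformly, as their weights are bounded above; then every
   conditional expectation is at most theta - delta. *)
Require Import Defs.
From mathcomp Require Import all_boot all_order all_algebra.
From mathcomp Require Import all_classical all_reals all_analysis.
From mathcomp Require Import measurable_realfun.
From mathcomp Require Import ring lra zify.

Set Implicit Arguments.
Unset Strict Implicit.
Unset Printing Implicit Defensive.

Import Order.TTheory GRing.Theory Num.Theory.

Local Open Scope ring_scope.

(** * Optimal stopping over the MDP *)

Section Envelope.
Local Open Scope classical_set_scope.
Variables (R : realType) (S Act : finType) (M : mdp S Act).
Implicit Types (s t : S) (a : Act) (f g : S -> R -> R) (x y z : R) (n : nat).

(** V is built as the value of an optimal stopping problem instead of as a supremum over schedulers:
    value iteration gives superharmonicity and conserving actions without measure theory, and
    integrals over runs enter only when finite-horizon expectations are turned into statements on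
    [CE] and [Pr]. The price is that stopping is not something a scheduler can do. Off the goal it
    is therefore charged [loss], a bound for the negative part that a safe continuation still
    produces; each finite horizon is then matched by a real scheduler with integrable negative part,
    and the bound theta transfers to V.

    The weight is unbounded in both directions, so no minimum over pairs of state and weight comes
    for free, and a scheduler that merely conserves V may postpone the goal forever. Compactness is
    recovered from the integrality of the weights, which leaves finitely many of them in each
    bounded window; the Lyapunov function pays for the rest. *)

Definition prob s a t : R := ratr (tr M s a t).
Definition weight s a : R := (wgt M s a)%:~R.

Local Notation pr := prob.
Local Notation wt := weight.

Lemma prob_ge0 s a t : 0 <= pr s a t.
Proof. by rewrite ler0q; case/andP: (tr_itv M s a t). Qed.

Lemma prob_gt0 s a t : (0 < pr s a t) = (0 < tr M s a t).
Proof. by rewrite ltr0q. Qed.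

Lemma prob_sum1 s a : a \in enabled M s -> \sum_t pr s a t = 1.
Proof. by rewrite inE -raddf_sum /= => /eqP ->; rewrite rmorph1. Qed.

Lemma tr_gt0_enabled s a t : 0 < tr M s a t -> a \in enabled M s.
Proof.
move=> p0; rewrite inE; case: (tr_sum M s a) => [s0|->//]; move: p0.
by rewrite (psumr_eq0P (fun u _ => (andP (tr_itv M s a u)).1) s0) ?ltxx.
Qed.

Definition step f s a y : R := \sum_t pr s a t * f t (y + wt s a).

Definition superharmonic f :=
  forall s a y, a \in enabled M s -> step f s a y <= f s y.

Lemma le_step f g s a y :
  (forall t, 0 < tr M s a t -> f t (y + wt s a) <= g t (y + wt s a)) ->
  step f s a y <= step g s a y.
Proof.
move=> fg; apply: ler_sum => t _; have := prob_ge0 s a t.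
by rewrite le_eqVlt prob_gt0 => /predU1P[<-|p0]; rewrite ?mul0r // ler_wpM2l ?prob_ge0 // fg.
Qed.

Lemma step_affine f s a y k l : a \in enabled M s ->
  step (fun t z => k * f t z + l) s a y = k * step f s a y + l.
Proof.
move=> aE; rewrite /step mulr_sumr -[in RHS](mulr1 l) -(prob_sum1 aE) mulr_sumr.
by rewrite -big_split /=; apply: eq_bigr => t _; ring.
Qed.

Lemma stepD f g s a y :
  step (fun t z => f t z + g t z) s a y = step f s a y + step g s a y.
Proof. by rewrite /step -big_split /=; apply: eq_bigr => t _; rewrite mulrDr. Qed.

Lemma step_shift f s a y z :
  step f s a (y + z) = step (fun t x => f t (x + z)) s a y.
Proof. by apply: eq_bigr => t _; rewrite addrAC. Qed.

Lemma step_le_cst f s a y k : a \in enabled M s ->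
  (forall t, 0 < tr M s a t -> f t (y + wt s a) <= k) -> step f s a y <= k.
Proof.
move=> aE fk; have /le_trans-> // : step f s a y <= step (fun _ _ => 0 * 0 + k) s a y.
  by apply: le_step => t p0; rewrite mul0r add0r fk.
by rewrite (step_affine (fun _ _ => 0)) // mul0r add0r.
Qed.

Lemma step_ge_cst f s a y k : a \in enabled M s ->
  (forall t, 0 < tr M s a t -> k <= f t (y + wt s a)) -> k <= step f s a y.
Proof.
move=> aE fk; have /(le_trans _)-> // : step (fun _ _ => 0 * 0 + k) s a y <= step f s a y.
  by apply: le_step => t p0; rewrite mul0r add0r fk.
by rewrite (step_affine (fun _ _ => 0)) // mul0r add0r.
Qed.

(** One successor is kept exactly and all others are replaced by their common lower bound [k]. *)
Lemma step_ge_term f s a y t k : a \in enabled M s -> 0 < tr M s a t -> 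
  (forall u, 0 < tr M s a u -> k <= f u (y + wt s a)) ->
  pr s a t * (f t (y + wt s a) - k) + k <= step f s a y.
Proof.
move=> aE p0 fk; have -> : step f s a y =
    step (fun u z => 1 * (f u z - k) + k) s a y.
  by apply: eq_bigr => u _; rewrite mul1r subrK.
rewrite (step_affine (fun u z => f u z - k)) // mul1r lerD2r /step (bigD1 t) //=.
rewrite lerDl; apply: sumr_ge0 => u _; have := prob_ge0 s a u.
rewrite le_eqVlt prob_gt0 => /predU1P[<-|u0]; first by rewrite mul0r.
by rewrite mulr_ge0 ?prob_ge0 // subr_ge0 fk.
Qed.

Definition some_act s : Act := sval (cid (tr_enabled M s)).

Lemma some_act_enabled s : some_act s \in enabled M s.
Proof. by rewrite inE; apply/eqP; exact: (svalP (cid (tr_enabled M s))). Qed.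

Definition best s (u : Act -> R) : R :=
  u [arg max_(a > some_act s | a \in enabled M s) u a]%O.

Lemma best_ge s u a : a \in enabled M s -> u a <= best s u.
Proof.
by rewrite /best; case: arg_maxP => [|b _ ub]; [exact: some_act_enabled|exact: ub].
Qed.

Lemma bestP s u : exists2 a, a \in enabled M s & best s u = u a.
Proof.
by rewrite /best; case: arg_maxP => [|b bE _]; [exact: some_act_enabled|exists b].
Qed.

Lemma best_le s u k : (forall a, a \in enabled M s -> u a <= k) -> best s u <= k.
Proof. by move=> uk; have [a aE ->] := bestP s u; apply: uk. Qed.

(* Value iteration: the optimal expected reward if one stops within n steps
   and stopping in state s with weight y is worth g s y. *)
Fixpoint viter g n s y : R :=
  if n is n'.+1 then Num.max (g s y) (best s (fun a => step (viter g n') s a y))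
  else g s y.
Arguments viter : simpl never.

Lemma viterS g n s y : viter g n.+1 s y =
  Num.max (g s y) (best s (fun a => step (viter g n) s a y)).
Proof. by []. Qed.

Lemma viter_ge g n s y : g s y <= viter g n s y.
Proof. by case: n => [|n]; rewrite ?viterS ?le_max lexx. Qed.

Lemma step_viter g n s a y : a \in enabled M s ->
  step (viter g n) s a y <= viter g n.+1 s y.
Proof. by move=> aE; rewrite viterS le_max (best_ge (fun a => step (viter g n) s a y) aE) orbT. Qed.

Lemma viter_leS g n s y : viter g n s y <= viter g n.+1 s y.
Proof.
elim: n s y => [|n IH] s y; first exact: (viter_ge g 1).
rewrite {1}viterS ge_max viter_ge /=; apply: best_le => a aE.
by apply: le_trans (step_viter _ _ _ aE); apply: le_step => t _.
Qed.

Lemma le_viter g m n s y : (m <= n)%N -> viter g m s y <= viter g n s y.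
Proof.
move=> /subnK <-; elim: (n - m)%N => // k IH.
by rewrite addSn (le_trans IH) // viter_leS.
Qed.

(** The dynamics commute with shifts of the weight, so an affine comparison of rewards survives
    value iteration. Instances: monotonicity ([rho = 1], [tau = 0]), the Lipschitz bound ([rho = 1],
    [tau = z]) and exponential scaling ([tau = 0]). *)
Lemma viter_shift g rho tau z : 0 <= rho -> 0 <= tau ->
  (forall s y, g s (y + z) <= rho * g s y + tau) ->
  forall n s y, viter g n s (y + z) <= rho * viter g n s y + tau.
Proof.
move=> rho0 tau0 gz; elim=> [|n IH] s y //; rewrite viterS ge_max.
apply/andP; split.
  by apply: le_trans (gz s y) _; rewrite lerD2r ler_wpM2l // viter_ge.
apply: best_le => a aE; rewrite step_shift.
apply: le_trans (_ : step (fun t x => rho * viter g n t x + tau) s a y <= _).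
  by apply: le_step.
by rewrite step_affine // lerD2r ler_wpM2l // step_viter.
Qed.

Definition bounded_viter g := forall s y, exists k, forall n, viter g n s y <= k.

(** The Snell envelope of [g]: when the iterates are bounded, it is the least superharmonic
    majorant, by [env_super] and [viter_least]. *)
Definition env g s y : R := sup (range (fun n => viter g n s y)).

Lemma env_le g s y k : (forall n, viter g n s y <= k) -> env g s y <= k.
Proof.
move=> gk; apply: ge_sup; first by exists (viter g 0 s y), 0.
by move=> _ [n _ <-].
Qed.

Section Bounded.
Variable g : S -> R -> R.
Hypothesis gB : bounded_viter g.

Lemma viter_le_env n s y : viter g n s y <= env g s y.
Proof.
apply: ub_le_sup; last by exists n.
by have [k gk] := gB s y; exists k => _ [m _ <-].
Qed.

Lemma env_ge s y : g s y <= env g s y.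
Proof. exact: (viter_le_env 0). Qed.

Lemma env_approx s y e : 0 < e -> exists n, env g s y - e < viter g n s y.
Proof.
move=> e0; have sP : has_sup (range (fun n => viter g n s y)).
  split; first by exists (viter g 0 s y), 0.
  by have [k gk] := gB s y; exists k => _ [m _ <-].
by have [_ [n _ <-] ?] := sup_adherent e0 sP; exists n.
Qed.

Lemma env_super : superharmonic (env g).
Proof.
move=> s a y aE; apply/ler_addgt0Pr => e e0.
(* There are finitely many successors, so the largest of their horizons serves all of them. *)
have /choice[N NP] : forall t, exists n, env g t (y + wt s a) - e < viter g n t (y + wt s a).
  by move=> t; apply: env_approx.
pose m := (\max_t N t)%N.
apply: le_trans (_ : step (fun t x => 1 * viter g m t x + e) s a y <= _).
  apply: le_step => t _; rewrite mul1r -lerBlDr; apply: le_trans (ltW (NP t)) _.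
  by apply: le_viter; rewrite (leq_bigmax t).
by rewrite step_affine // mul1r lerD2r (le_trans (step_viter _ _ _ aE)) // viter_le_env.
Qed.

Lemma env_shift rho tau z : 0 <= rho -> 0 <= tau ->
  (forall s y, g s (y + z) <= rho * g s y + tau) ->
  forall s y, env g s (y + z) <= rho * env g s y + tau.
Proof.
move=> rho0 tau0 gz s y; apply: env_le => n.
apply: le_trans (viter_shift rho0 tau0 gz n s y) _.
by rewrite lerD2r ler_wpM2l // viter_le_env.
Qed.

(* When stopping is never better than continuing, an optimal action exists. *)
Lemma env_conserving s y :
  (exists2 a, a \in enabled M s & g s y <= step g s a y) ->
  exists2 a, a \in enabled M s & step (env g) s a y = env g s y.
Proof.
move=> [b bE gb]; have [a aE aM] := bestP s (fun a => step (env g) s a y).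
exists a => //; apply/le_anti; rewrite env_super //= -aM; apply: env_le => -[|n].
  apply: le_trans (best_ge _ bE); apply: le_trans gb _.
  by apply: le_step => t _; exact: env_ge.
rewrite viterS ge_max; apply/andP; split.
  apply: le_trans (best_ge _ bE); apply: le_trans gb _.
  by apply: le_step => t _; exact: env_ge.
apply: best_le => c cE; apply: le_trans (best_ge _ cE).
by apply: le_step => t _; exact: viter_le_env.
Qed.

End Bounded.

Lemma viter_least g f : (forall s y, g s y <= f s y) -> superharmonic f ->
  forall n s y, viter g n s y <= f s y.
Proof.
move=> gf fS; elim=> [|n IH] s y //; rewrite viterS ge_max gf /=; apply: best_le => a aE.
by apply: le_trans (fS _ _ _ aE); apply: le_step => t _.
Qed.

End Envelope.

(** * States that force the goal, and the stopping reward *)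

Section Attractor.
Variables (R : realType) (S Act : finType) (M : mdp S Act) (goal : S).
Implicit Types (s t : S) (a : Act) (f g : S -> R -> R) (x y z : R) (n : nat).

Local Notation pr := (@prob R S Act M).
Local Notation wt := (@weight R S Act M).

Fact wmax_proof : {k : R | 0 <= k /\ forall s a, - k <= wt s a <= k}.
Proof.
exists (\sum_s \sum_a `|wt s a|); split; first by do 2 apply: sumr_ge0 => ? _.
move=> s a; rewrite -ler_norml (bigD1 s) //= (bigD1 a) //= -addrA lerDl.
by apply: addr_ge0; do ?[apply: sumr_ge0 => ? _ //].
Qed.

Definition wmax : R := sval wmax_proof.

Lemma wmax_ge0 : 0 <= wmax.
Proof. by have [] := svalP wmax_proof. Qed.

Lemma wt_le s a : - wmax <= wt s a <= wmax.
Proof. by have [] := svalP wmax_proof. Qed.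

Fact pmin_proof :
  {p : R | 0 < p <= 1 /\ forall s a t, 0 < tr M s a t -> p <= pr s a t}.
Proof.
exists (\big[Num.min/1]_(u : S * Act * S | 0 < pr u.1.1 u.1.2 u.2) pr u.1.1 u.1.2 u.2).
split=> [|s a t]; first by rewrite lt_bigmin // bigmin_le_id.
rewrite -(prob_gt0 R) => p0.
exact: (bigmin_le_cond 1 (fun u => pr u.1.1 u.1.2 u.2) (j := ((s, a), t))).
Qed.

Definition pmin : R := sval pmin_proof.

Lemma pmin_itv : 0 < pmin <= 1.
Proof. by have [] := svalP pmin_proof. Qed.

Lemma pmin_le s a t : 0 < tr M s a t -> pmin <= pr s a t.
Proof. by have [_] := svalP pmin_proof; apply. Qed.

Lemma step_le_term f s a y t k : a \in enabled M s -> 0 < tr M s a t ->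
  (forall u, 0 < tr M s a u -> f u (y + wt s a) <= k) ->
  step M f s a y <= k - pmin * (k - f t (y + wt s a)).
Proof.
move=> aE p0 fk.
have := @step_ge_term R _ _ M (fun u z => -1 * f u z + 0) s a y t (- k) aE p0.
rewrite step_affine // => H; have {}H := H _.
have := ler_wpM2r (_ : 0 <= k - f t (y + wt s a)) (pmin_le p0).
rewrite subr_ge0 => /(_ (fk _ p0)) ?.
have : forall u, 0 < tr M s a u -> - k <= -1 * f u (y + wt s a) + 0.
  by move=> u /fk; rewrite mulN1r addr0 lerN2.
move=> /H; lra.
Qed.

Lemma absorbing_tr s a t : absorbing M s -> a \in enabled M s ->
  wgt M s a = 0 /\ tr M s a t = (t == s)%:R.
Proof.
move=> [b [bE b1 w0]] aE; have ab : a = b by move: aE; rewrite bE => /set1P.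
rewrite {}ab in aE *; split=> //; move: aE; rewrite inE (bigD1 s) //= b1.
rewrite -[X in _ == X]addr0 (inj_eq (addrI 1)) => /eqP s0.
have [->|ts] := eqVneq t s; first by rewrite b1.
by apply: (psumr_eq0P _ s0) => // u _; case/andP: (tr_itv M s b u).
Qed.

Lemma absorbing_succ s a t : absorbing M s -> a \in enabled M s ->
  0 < tr M s a t -> t = s.
Proof.
by move=> sA /(absorbing_tr t sA)[_ ->]; case: eqP => //; rewrite ltxx.
Qed.

Lemma absorbing_step f s a y : absorbing M s -> a \in enabled M s ->
  step M f s a y = f s y.
Proof.
move=> sA aE; rewrite /step (bigD1 s) //= big1 => [|t ts].
  rewrite /prob /weight; have [-> ->] := absorbing_tr s sA aE.
  by rewrite eqxx rmorph1 mul1r !addr0.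
rewrite /prob; have [_ ->] := absorbing_tr t sA aE.
by rewrite (negPf ts) raddf0 mul0r.
Qed.

Hypothesis goal_absorbing : absorbing M goal.

Definition attract (X : {set S}) : {set S} := [set s | (s == goal) ||
  [forall a in enabled M s, exists t in X, 0 < tr M s a t]]%SET.

Lemma attract_mono : {homo attract : X Y / X \subset Y}.
Proof.
move=> X Y /fintype.subsetP XY; apply/fintype.subsetP => s.
rewrite !inE => /predU1P[->|/forall_inP sX].
  by rewrite eqxx.
apply/orP; right; apply/forall_inP => a /sX/exists_inP[t tX p0].
by apply/exists_inP; exists t => //; apply: XY.
Qed.

(* The states from which no scheduler avoids the goal surely. *)
Definition forced : {set S} := fixset attract.

Definition rank s : nat := fix_order attract s.

Lemma goal_forced : goal \in forced.
Proof. by rewrite /forced -(fixsetK attract_mono) inE eqxx. Qed.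

Lemma forced_succ s a : s \in forced -> s != goal -> a \in enabled M s ->
  exists t, [/\ t \in forced, 0 < tr M s a t & (rank t < rank s)%N].
Proof.
move=> sF sg aE; have r0 : (0 < rank s)%N by rewrite fix_order_gt0.
have : s \in iter (rank s) attract finset.set0 by rewrite in_iter_fix_orderE.
rewrite -(prednK r0) /= {1}/attract inE (negPf sg) => /forall_inP/(_ a aE)/exists_inP[t].
by rewrite (in_iter_fixE attract_mono) => /andP[t0 tr] p0; exists t; rewrite -fix_order_gt0.
Qed.

Lemma safe_succ s : s \notin forced ->
  exists2 a, a \in enabled M s & forall t, 0 < tr M s a t -> t \notin forced.
Proof.
rewrite {1}/forced -(fixsetK attract_mono) inE negb_or => /andP[_].
move=> /forall_inPn[a aE /exists_inPn ts]; exists a => // t p0.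
by apply/negP => /ts; rewrite p0.
Qed.

(** If B met [forced], an action that stays in B would still have a successor of smaller rank in
    [forced]; the descent could only end at the goal, which is not in B. *)
Lemma safe_coind (B : S -> Prop) : ~ B goal ->
  (forall s, B s -> exists2 a, a \in enabled M s & forall t, 0 < tr M s a t -> B t) ->
  forall s, B s -> s \notin forced.
Proof.
move=> Bg BS s Bs; apply/negP => sF.
have [n] := ubnP (rank s); elim: n s Bs sF => // n IH s Bs sF rn.
have sg : s != goal by apply/eqP => sg; apply: Bg; rewrite -sg.
have [a aE aB] := BS s Bs.
have [t [tF p0 tr]] := forced_succ sF sg aE.
by apply: (IH t) => //; [exact: aB | exact: leq_trans tr _].
Qed.

Definition negp y : R := Num.max (- y) 0.

Lemma negp_ge0 y : 0 <= negp y. Proof. by rewrite le_max lexx orbT. Qed.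

Lemma negp_geN y : - y <= negp y. Proof. by rewrite le_max lexx. Qed.

Lemma negp_le y k : - y <= k -> 0 <= k -> negp y <= k.
Proof. by rewrite ge_max => -> ->. Qed.

Lemma negp_wt y s a : negp (y + wt s a) <= negp y + wmax.
Proof.
have := wt_le s a; have := negp_geN y; have := negp_ge0 y; have := wmax_ge0.
by move=> *; apply: negp_le; lra.
Qed.

Let leave_arith (k l w p r u : R) : 0 < p -> k <= u * (1 - r) ->
  l <= u * (p / 2 * r) -> w <= u - p * (u - k) -> l + w <= u * (1 - p / 2 * r).
Proof.
move=> p0; rewrite -subr_ge0 => /(mulr_ge0 (ltW p0)); lra.
Qed.

(* The witness bounds the loss of weight before the forced states are left: by
   [forced_succ], the rank decreases with probability at least pmin. *)
Fact leave_proof : {h : S -> R | (exists k, forall s, 0 <= h s <= k) /\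
  forall s a, s \in forced -> s != goal -> a \in enabled M s ->
    wmax + \sum_(t | (t \in forced) && (t != goal)) pr s a t * h t <= h s}.
Proof.
(* The witness is [L * (1 - q ^+ rank s)]. A successor of smaller rank makes its expectation at most
   [L - pmin * L * q ^+ (rank s).-1], which is [L - 2 * L * q ^+ rank s]. Half of this gain is kept;
   the other half pays for [wmax], since [wmax <= L * q ^+ rank s] for every rank. *)
pose q := pmin / 2; have [p0 p1] := andP pmin_itv.
have q0 : 0 < q by rewrite divr_gt0.
have q1 : q <= 1 by rewrite /q; lra.
pose L := wmax / q ^+ #|S|.
have L0 : 0 <= L by rewrite divr_ge0 ?wmax_ge0 // exprn_ge0 // ltW.
have r1 s : q ^+ rank s <= 1 by rewrite exprn_ile1 // ltW.
have hle s : 0 <= L * (1 - q ^+ rank s) <= L.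
  by rewrite mulr_ge0 ?subr_ge0 //= ler_piMr // gerBl exprn_ge0 // ltW.
exists (fun s => L * (1 - q ^+ rank s)); split.
  by exists L => s; exact: hle.
move=> s a sF sg aE; have [t [tF pt tr]] := forced_succ sF sg aE.
pose f u (_ : R) := if (u \in forced) && (u != goal) then L * (1 - q ^+ rank u) else 0.
have fL u z : f u z <= L by rewrite /f; case: ifP => // _; case/andP: (hle u).
have -> : \sum_(u | (u \in forced) && (u != goal)) pr s a u * (L * (1 - q ^+ rank u)) =
    step M f s a 0.
  by rewrite big_mkcond; apply: eq_bigr => u _; rewrite /f; case: ifP => // _; rewrite mulr0.
have ft : f t (0 + wt s a) <= L * (1 - q ^+ (rank s).-1).
  have H : 1 - q ^+ rank t <= 1 - q ^+ (rank s).-1.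
    rewrite lerD2l lerN2 ler_wiXn2l //; first exact: ltW.
    by rewrite -ltnS prednK // (leq_ltn_trans _ tr).
  rewrite /f; case: ifP => _; first by rewrite ler_wpM2l.
  by rewrite mulr_ge0 // subr_ge0 exprn_ile1 // ltW.
have := step_le_term aE pt (fun u _ => fL u _).
have Q : wmax <= L * q ^+ rank s.
  rewrite /L -mulrA ler_peMr ?wmax_ge0 // mulrC ler_pdivlMr ?exprn_gt0 // mul1r.
  by rewrite ler_wiXn2l // ?fix_order_le_max // ltW.
have rE : q ^+ rank s = pmin / 2 * q ^+ (rank s).-1.
  by rewrite -exprS prednK // (leq_ltn_trans _ tr).
by rewrite rE in Q *; move/(_ 0); apply: leave_arith p0 ft Q.
Qed.

Definition leave s : R := sval leave_proof s.

Lemma leave_ge0 s : 0 <= leave s.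
Proof. by have [[k /(_ s)/andP[]]] := svalP leave_proof. Qed.

(* A bound for the expected negative part of the reward under the scheduler
   that stays outside [forced] forever once it is there. *)
Definition loss s y : R :=
  if s == goal then negp y else if s \in forced then negp y + leave s else 0.

(** The charge for stopping off the goal makes stopping never better than a safe action
    ([stop_step]). *)
Definition stop s y : R := if s == goal then y else - loss s y.

Lemma loss_ge0 s y : 0 <= loss s y.
Proof.
rewrite /loss; have := negp_ge0 y; have := leave_ge0 s.
by case: ifP => _; [|case: ifP => _]; lra.
Qed.

Lemma loss_le : exists k, 0 <= k /\ forall s y, loss s y <= negp y + k.
Proof.
have [[k hk] _] := svalP leave_proof.
have k0 : 0 <= k by have := hk goal => /andP[]; apply: le_trans.
exists k; split=> // s y; have /andP[_] := hk s; have := negp_ge0 y.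
by rewrite /loss -/(leave s); case: ifP => _; [|case: ifP => _]; lra.
Qed.

Lemma loss_step s a y : a \in enabled M s ->
  (s \notin forced -> forall t, 0 < tr M s a t -> t \notin forced) ->
  step M loss s a y <= loss s y.
Proof.
case: (eqVneq s goal) => [->|sg] aE safe.
  by rewrite absorbing_step.
have [sF|sF] := boolP (s \in forced); last first.
  rewrite [leRHS]/loss (negPf sg) (negPf sF); apply: step_le_cst => // t p0.
  have tF := safe sF t p0; rewrite /loss (negPf tF); case: eqP => // tg.
  by move: tF; rewrite tg goal_forced.
have [_ /(_ s a sF sg aE) H] := svalP leave_proof.
pose f u (_ : R) := if (u \in forced) && (u != goal) then leave u else 0.
have -> : loss s y = 1 * leave s + negp y.
  by rewrite /loss (negPf sg) sF mul1r addrC.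
apply: le_trans (_ : step M (fun u z => 1 * f u z + (negp y + wmax)) s a y <= _).
  apply: le_step => t _; have := negp_wt y s a; have := wmax_ge0; have := negp_ge0 y.
  rewrite /loss /f; case: eqP => _; rewrite ?andbF ?andbT; first lra.
  by case: ifP => _; lra.
rewrite step_affine // !mul1r [negp y + _]addrC addrA lerD2r addrC.
apply: le_trans H; rewrite lerD2l [leRHS]big_mkcond; apply: ler_sum => t _.
by rewrite /f; case: ifP => _; rewrite ?mulr0.
Qed.

End Attractor.
Arguments negp {R} y.

(** * Finite-horizon expectations *)

Section Expectation.
Variables (R : realType) (S Act : finType) (M : mdp S Act).
Variable sigma : scheduler R M.
Implicit Types (s t : S) (a : Act) (f g : S -> R -> R) (x y z : R) (n : nat).
Implicit Types (u : Act * S) (p : fin_path S Act) (F G : fin_path S Act -> R).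

Local Notation pr := (@prob R S Act M).
Local Notation wt := (@weight R S Act M).

Fixpoint ev n F p : R :=
  if n is n'.+1 then
    \sum_u sigma p u.1 * pr (last_st p) u.1 u.2 * ev n' F (extend p u)
  else F p.
Arguments ev : simpl never.

Lemma evS n F p : ev n.+1 F p =
  \sum_u sigma p u.1 * pr (last_st p) u.1 u.2 * ev n F (extend p u).
Proof. by []. Qed.

Lemma ev_add m n F p : ev (m + n) F p = ev m (ev n F) p.
Proof.
elim: m p => // m IH p; rewrite addSn !evS.
by apply: eq_bigr => u _; rewrite IH.
Qed.

Lemma size_extend p u : size (extend p u).2 = (size p.2).+1.
Proof. by rewrite size_rcons. Qed.

Lemma last_extend p u : last_st (extend p u) = u.2.
Proof. by rewrite /last_st /extend /= /unzip2 map_rcons last_rcons. Qed.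

Lemma wgt_extend p u :
  path_wgt M (extend p u) = path_wgt M p + wgt M (last_st p) u.1.
Proof.
case: p u => s h [a t]; rewrite /path_wgt /last_st /=.
elim: h s => [|[b v] h IH] s /=; first by rewrite addr0 add0r.
by rewrite IH addrA.
Qed.

Lemma le_ev n F G p : is_path M p ->
  (forall q, is_path M q -> size q.2 = (size p.2 + n)%N -> F q <= G q) ->
  ev n F p <= ev n G p.
Proof.
elim: n p => [|n IH] p pP FG; first by apply: FG; rewrite ?addn0.
rewrite !evS; apply: ler_sum => u _; have := prob_ge0 R M (last_st p) u.1 u.2.
rewrite le_eqVlt prob_gt0 => /predU1P[<-|p0]; first by rewrite mulr0 !mul0r.
apply: ler_wpM2l; first by rewrite mulr_ge0 ?sched_ge0 ?prob_ge0.
apply: IH => [|q qP sq]; first by rewrite is_path_extend pP.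
by apply: FG => //; rewrite sq size_extend addSnnS.
Qed.

Lemma eq_ev n F G p : F =1 G -> ev n F p = ev n G p.
Proof. by move=> /funext ->. Qed.

Lemma ev_lin n F G k l p :
  ev n (fun q => k * F q + l * G q) p = k * ev n F p + l * ev n G p.
Proof.
elim: n p => [|n IH] p //; rewrite !evS !mulr_sumr -big_split /=.
by apply: eq_bigr => u _; rewrite IH; ring.
Qed.

Lemma ev1E F p : ev 1 F p =
  \sum_a sigma p a * \sum_t pr (last_st p) a t * F (extend p (a, t)).
Proof.
rewrite evS; transitivity (\sum_u sigma p u.1 * pr (last_st p) u.1 u.2 *
  F (extend p (u.1, u.2))); first by apply: eq_bigr => -[].
rewrite -(pair_bigA _ (fun a t => sigma p a * pr (last_st p) a t * F (extend p (a, t)))) /=.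
by apply: eq_bigr => a _; rewrite mulr_sumr; apply: eq_bigr => t _; rewrite mulrA.
Qed.

Lemma ev1_le F p k : is_path M p ->
  (forall a, a \in enabled M (last_st p) ->
    \sum_t pr (last_st p) a t * F (extend p (a, t)) <= k) -> ev 1 F p <= k.
Proof.
move=> pP Fk; rewrite ev1E -(mul1r k) -(sched_sum sigma pP) mulr_suml.
apply: ler_sum => a _; have [aE|aE] := boolP (a \in enabled M (last_st p)).
  by rewrite ler_wpM2l ?sched_ge0 ?Fk.
by rewrite (sched_enabled sigma pP aE) !mul0r.
Qed.

Lemma ev1_ge F p k : is_path M p ->
  (forall a, a \in enabled M (last_st p) ->
    k <= \sum_t pr (last_st p) a t * F (extend p (a, t))) -> k <= ev 1 F p.
Proof.
move=> pP Fk; rewrite ev1E -(mul1r k) -(sched_sum sigma pP) mulr_suml.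
apply: ler_sum => a _; have [aE|aE] := boolP (a \in enabled M (last_st p)).
  by rewrite ler_wpM2l ?sched_ge0 ?Fk.
by rewrite (sched_enabled sigma pP aE) !mul0r.
Qed.

Lemma ev_cst n k p : is_path M p -> ev n (fun=> k) p = k.
Proof.
elim: n p => [|n IH] p pP //; rewrite -addn1 ev_add.
(* Off the paths the scheduler need not be a probability distribution, so the equality is claimed on
   paths only. *)
have -> : ev 1 (fun=> k) = fun q => if is_path M q then k else ev 1 (fun=> k) q.
  apply/funext => q; case: ifP => // qP; rewrite ev1E.
  rewrite -[RHS]mul1r -(sched_sum sigma qP) mulr_suml; apply: eq_bigr => a _.
  have [aE|aE] := boolP (a \in enabled M (last_st q)).
    by rewrite -mulr_suml prob_sum1 // mul1r.
  by rewrite (sched_enabled sigma qP aE) !mul0r.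
rewrite -[RHS](IH _ pP); apply/le_anti; rewrite !le_ev // => q -> //.
Qed.

Lemma ev_super n F p : is_path M p ->
  (forall q, is_path M q -> (size p.2 <= size q.2)%N -> ev 1 F q <= F q) ->
  ev n F p <= F p.
Proof.
move=> pP FS; elim: n => // n IH; rewrite -addn1 ev_add; apply: le_trans IH.
by apply: le_ev => // q qP sq; apply: FS; rewrite ?sq ?leq_addr.
Qed.

Lemma ev_sub n F p : is_path M p ->
  (forall q, is_path M q -> (size p.2 <= size q.2)%N -> F q <= ev 1 F q) ->
  F p <= ev n F p.
Proof.
move=> pP FS; elim: n => // n IH; rewrite -addn1 ev_add; apply: le_trans IH _.
by apply: le_ev => // q qP sq; apply: FS; rewrite ?sq ?leq_addr.
Qed.

Variable theta : R.

Definition excess p : R := (path_wgt M p)%:~R - theta.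

Definition at_ f p : R := f (last_st p) (excess p).

Lemma at_extend f p u :
  at_ f (extend p u) = f u.2 (excess p + wt (last_st p) u.1).
Proof. by rewrite /at_ last_extend /excess wgt_extend rmorphD addrAC. Qed.

Lemma at_step f p a : \sum_t pr (last_st p) a t * at_ f (extend p (a, t)) =
  step M f (last_st p) a (excess p).
Proof. by apply: eq_bigr => t _; rewrite at_extend. Qed.

(** Superharmonicity is asked only at the points that weights of paths can attain; the majorant in
    [init_reaches] is known to have it only there. *)
Lemma ev_superharmonic n f p : is_path M p ->
  (forall s a (w : int), a \in enabled M s ->
    step M f s a (w%:~R - theta) <= f s (w%:~R - theta)) ->
  ev n (at_ f) p <= at_ f p.
Proof.
move=> pP fS; apply: ev_super => // q qP _.
by apply: ev1_le => // a aE; rewrite at_step fS.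
Qed.

Lemma le_ev_at n f g p : is_path M p ->
  (forall s (w : int), f s (w%:~R - theta) <= g s (w%:~R - theta)) ->
  ev n (at_ f) p <= ev n (at_ g) p.
Proof. by move=> pP fg; apply: le_ev => // q _ _; apply: fg. Qed.

Variable goal : S.
Hypothesis goal_absorbing : absorbing M goal.

Definition on_goal (k : R -> R) s y : R := if s == goal then k y else 0.

Lemma on_goal_step k s a y : (forall z, 0 <= k z) -> a \in enabled M s ->
  on_goal k s y <= step M (on_goal k) s a y.
Proof.
move=> k0; case: (eqVneq s goal) => [->|sg] aE.
  by rewrite absorbing_step.
rewrite {1}/on_goal (negPf sg); apply: step_ge_cst => // t _.
by rewrite /on_goal; case: ifP.
Qed.

(** A run at the goal stays there with its weight unchanged, so a longer horizon can only add
    nonnegative terms. *)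
Lemma le_ev_on_goal m n k p : is_path M p -> (forall z, 0 <= k z) -> (m <= n)%N ->
  ev m (at_ (on_goal k)) p <= ev n (at_ (on_goal k)) p.
Proof.
move=> pP k0 /subnKC <-; rewrite ev_add; apply: le_ev => // q qP _.
apply: ev_sub => // r rP _; apply: ev1_ge => // a aE.
by rewrite at_step on_goal_step.
Qed.

End Expectation.
Arguments ev : simpl never.

Section DeterministicScheduler.
Variables (R : realType) (S Act : finType) (M : mdp S Act).
Variable pol : fin_path S Act -> Act.
Hypothesis pol_enabled : forall p, pol p \in enabled M (last_st p).
Implicit Types (p : fin_path S Act).

Definition det_scheduler : scheduler R M.
Proof.
refine (@Scheduler S Act R M (fun p a => (a == pol p)%:R) _ _ _).
- by move=> p _ a; exact: ler0n.
- by move=> p _; rewrite (bigD1 (pol p)) //= eqxx big1 ?addr0 // => a /negPf ->.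
- by move=> p _ a; case: eqP => // ->; rewrite pol_enabled.
Defined.

Lemma det_deterministic : deterministic det_scheduler.
Proof. by move=> p _; exists (pol p). Qed.

Lemma det_ev1 F p : ev det_scheduler 1 F p =
  \sum_t prob R M (last_st p) (pol p) t * F (extend p (pol p, t)).
Proof.
rewrite ev1E (bigD1 (pol p)) //= eqxx mul1r [X in _ + X]big1 ?addr0 // => a ap.
by rewrite (negPf ap) mul0r.
Qed.

End DeterministicScheduler.

(** * The law of the runs and the conditional expectation *)

Section Law.
Local Open Scope classical_set_scope.
Variables (R : realType) (S Act : finType) (M : mdp S Act).
Variable sigma : scheduler R M.
Implicit Types (s t : S) (a : Act) (n : nat) (u : Act * S).
Implicit Types (p : fin_path S Act) (F G : fin_path S Act -> R) (w : runs M).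

Lemma ev_sum n F p : ev sigma n F p =
  \sum_(h : n.-tuple (Act * S)) steps_prob sigma p h * F (p.1, p.2 ++ h).
Proof.
elim: n p => [|n IH] p.
  rewrite /ev (big_pred1 [tuple]) => [|h]; last by apply/esym/eqP/tuple0.
  by rewrite /= cats0 mul1r; case: p.
rewrite evS; under eq_bigr do rewrite IH mulr_sumr.
rewrite pair_bigA /= (reindex (fun h : n.+1.-tuple (Act * S) => (thead h, behead_tuple h))) /=.
  apply: eq_bigr => h _; case/tupleP: h => u h; rewrite theadE /= -!mulrA cat_rcons.
  by do 3![congr (_ * _)]; rewrite /behead_tuple; congr (steps_prob _ _ _ * F (_, _ ++ _ :: _)).
exists (fun v => cons_tuple v.1 v.2) => [h _|[u h] _] /=.
  by case/tupleP: h => u h; apply: val_inj.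
by congr pair; apply: val_inj.
Qed.

Lemma measurable_cylinder p : measurable (cylinder M p : set (runs M)).
Proof. by apply: sub_sigma_algebra; exists p. Qed.

Lemma prefix_sum n F w : F (Defs.prefix w n) =
  \sum_(j : S * n.-tuple (Act * S)) F (j.1, tval j.2) *
    \1_(cylinder M (j.1, tval j.2) : set (runs M)) w.
Proof.
pose v : S * (nat -> Act * S) := w.
have sz : size (mkseq v.2 n) == n by rewrite size_mkseq.
rewrite (bigD1 (v.1, Tuple sz)) //= big1 => [|[s h] jw].
  by rewrite indicE mem_set ?mulr1 ?addr0 // /cylinder /= /Defs.prefix /= size_mkseq.
rewrite indicE memNset ?mulr0 // /cylinder /= size_tuple => E.
move/eqP: jw; apply; case: E => <- hE; congr pair; exact: val_inj.
Qed.

Lemma measurable_prefix n F :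
  measurable_fun [set: runs M] (fun w => F (Defs.prefix w n)).
Proof.
under [X in measurable_fun _ X]funext do rewrite prefix_sum.
apply: measurable_sum => j; apply: measurable_funM => //.
exact: measurable_indic (measurable_cylinder _).
Qed.

(** The bridge from the measure to [ev]: a function of the first n steps is a finite combination of
    indicators of cylinders, whose probabilities are known. *)
Lemma integral_prefix n F s : (forall p, 0 <= F p) ->
  (\int[Pr sigma s]_w (F (Defs.prefix w n))%:E)%E = (ev sigma n F (s, [::]))%:E.
Proof.
move=> F0; under eq_integral do rewrite prefix_sum -sumEFin.
rewrite ge0_integral_sum //; last first.
- by move=> j w _; rewrite lee_fin mulr_ge0 // indicE ler0n.
- move=> j; apply/measurable_EFinP; apply: measurable_funM => //.
  exact: measurable_indic (measurable_cylinder _).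
rewrite ev_sum -sumEFin -(pair_bigA _ (fun t (h : n.-tuple (Act * S)) =>
  \int[Pr sigma s]_w (F (t, tval h) * \1_(cylinder M (t, tval h) : set (runs M)) w)%:E)%E) /=.
have int1 t (h : n.-tuple (Act * S)) :
    (\int[Pr sigma s]_w (F (t, tval h) * \1_(cylinder M (t, tval h) : set (runs M)) w)%:E)%E =
    (F (t, tval h) * ((t == s)%:R * steps_prob sigma (s, [::]) h))%:E.
  under eq_integral do rewrite EFinM.
  rewrite ge0_integralZl_EFin //; last first.
    apply/measurable_EFinP; exact: measurable_indic (measurable_cylinder _).
  rewrite (integral_indic _ measurableT (measurable_cylinder _)) setIT EFinM.
  by congr (_ * _)%E; exact: Pr_cylinder.
rewrite (bigD1 s) //= [X in (_ + X)%E]big1 => [|t ts]; last first.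
  by rewrite big1 // => h _; rewrite int1 (negPf ts) mul0r mulr0.
by rewrite adde0; apply: eq_bigr => h _; rewrite int1 eqxx mul1r mulrC.
Qed.

End Law.

Section Reach.
Local Open Scope classical_set_scope.
Variables (R : realType) (S Act : finType) (M : mdp S Act) (goal : S).
Hypothesis goal_absorbing : absorbing M goal.
Implicit Types (s t : S) (a : Act) (n k : nat) (u : Act * S).
Implicit Types (p : fin_path S Act) (w : runs M) (g : int -> R).

Lemma stay_at_goal s h1 h2 : is_path M (s, h1 ++ h2) ->
  last_st (s, h1) = goal -> last_st (s, h1 ++ h2) = goal /\
  path_wgt M (s, h1 ++ h2) = path_wgt M (s, h1).
Proof.
elim/last_ind: h2 => [|h2 u IH]; first by rewrite cats0.
rewrite -rcons_cat -[(s, rcons _ _)]/(extend (s, h1 ++ h2) u) is_path_extend.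
move=> /andP[hP u0] h1g; have [lg wE] := IH hP h1g.
rewrite last_extend wgt_extend wE; rewrite lg in u0 *.
have uE := tr_gt0_enabled u0; split; first exact: absorbing_succ u0.
by have [-> _] := absorbing_tr goal goal_absorbing uE; rewrite addr0.
Qed.

(** When the goal is not visited, [find] returns [(size p.2).+1]; the test in [since_goal] relies on
    this value. *)
Definition first_goal p : nat :=
  find (fun k => last_st (p.1, take k p.2) == goal) (iota 0 (size p.2).+1).

Definition at_goal g p : R := if last_st p == goal then g (path_wgt M p) else 0.

(** Reading the weight at the first visit agrees with [at_goal] on paths. The sample space also
    contains sequences that are not paths, and there only the first-visit version is monotone in the
    length of the prefix, as monotone convergence requires. *)
Definition since_goal g p : R :=
  if (first_goal p <= size p.2)%N then g (path_wgt M (p.1, take (first_goal p) p.2))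
  else 0.

Lemma since_goalE g p : is_path M p -> since_goal g p = at_goal g p.
Proof.
case: p => s h hP; rewrite /since_goal /at_goal /=.
case: leqP => [fh|hf].
  have : has (fun k => last_st (s, take k h) == goal) (iota 0 (size h).+1).
    by rewrite has_find size_iota ltnS.
  move=> /(nth_find 0%N); rewrite nth_iota ?ltnS // add0n => /eqP fg.
  have := @stay_at_goal s (take (first_goal (s, h)) h) (drop (first_goal (s, h)) h).
  by rewrite cat_take_drop => /(_ hP fg)[-> ->]; rewrite eqxx.
case: eqP => // hg.
have : has (fun k => last_st (s, take k h) == goal) (iota 0 (size h).+1).
  by apply/hasP; exists (size h); rewrite ?mem_iota ?ltnS ?leqnn // take_size hg.
by rewrite has_find size_iota ltnS leqNgt hf.
Qed.

Lemma take_prefix w k n : (k <= n)%N ->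
  ((Defs.prefix w n).1, take k (Defs.prefix w n).2) = Defs.prefix w k.
Proof. by move=> kn; rewrite /= /mkseq -map_take take_iota (minn_idPl kn). Qed.

Lemma since_goal_prefix g w n : since_goal g (Defs.prefix w n) =
  if pselect (exists k, hits M goal w k) is left h then
    if (ex_minn h <= n)%N then g (path_wgt M (Defs.prefix w (ex_minn h))) else 0
  else 0.
Proof.
have sz : size (Defs.prefix w n).2 = n by rewrite size_mkseq.
have fgE : first_goal (Defs.prefix w n) = find (hits M goal w) (iota 0 n.+1).
  rewrite /first_goal sz; apply: eq_in_find => k; rewrite mem_iota add0n ltnS => kn.
  by rewrite take_prefix.
rewrite /since_goal sz; case: pselect => [h|nh] /=; last first.
  case: leqP => // fn; case: nh; exists (first_goal (Defs.prefix w n)).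
  have : has (hits M goal w) (iota 0 n.+1) by rewrite has_find -fgE size_iota ltnS.
  by move=> /(nth_find 0%N); rewrite -fgE nth_iota ?ltnS.
case: ex_minnP => m mw mmin; case: (leqP m n) => mn.
  have hf : has (hits M goal w) (iota 0 n.+1).
    by apply/hasP; exists m => //; rewrite mem_iota add0n ltnS.
  have fn : (first_goal (Defs.prefix w n) <= n)%N by move: hf; rewrite has_find -fgE size_iota ltnS.
  have fm : first_goal (Defs.prefix w n) = m.
    apply/eqP; rewrite eqn_leq; apply/andP; split; last first.
      by apply: mmin; move: (nth_find 0%N hf); rewrite -fgE nth_iota ?ltnS.
    rewrite leqNgt; apply/negP => mf; have := @before_find _ 0%N (hits M goal w) (iota 0 n.+1) m.
    by rewrite -fgE => /(_ mf); rewrite nth_iota ?ltnS // add0n mw.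
  by rewrite fn take_prefix // fm.
case: leqP => // fn; suff : (m <= n)%N by rewrite leqNgt mn.
have hf : has (hits M goal w) (iota 0 n.+1) by rewrite has_find -fgE size_iota ltnS.
apply: leq_trans (fn); apply: mmin.
by move: (nth_find 0%N hf); rewrite -fgE nth_iota ?ltnS.
Qed.

Lemma integral_reach (sigma : scheduler R M) s g : (forall z, 0 <= g z) ->
  (\int[Pr sigma s]_(w in reach M goal)
     (if pselect (exists k, hits M goal w k) is left h
      then g (path_wgt M (Defs.prefix w (ex_minn h))) else 0)%:E)%E =
  ereal_sup (range (fun n => (ev sigma n (at_goal g) (s, [::]))%:E)).
Proof.
move=> g0; pose f n w := (since_goal g (Defs.prefix w n))%:E.
have sg0 p : 0 <= since_goal g p by rewrite /since_goal; case: ifP => _ //; exact: g0.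
have f_nd w : {homo f^~ w : m n / (m <= n)%N >-> (m <= n)%E}.
  move=> m n mn; rewrite /f lee_fin !since_goal_prefix; case: pselect => // h.
  have [hm|hm] := leqP (ex_minn h) m; first by rewrite (leq_trans hm mn).
  by case: ifP.
have -> : (\int[Pr sigma s]_(w in reach M goal)
     (if pselect (exists k, hits M goal w k) is left h
      then g (path_wgt M (Defs.prefix w (ex_minn h))) else 0)%:E)%E =
   (\int[Pr sigma s]_w limn (f^~ w))%E.
  rewrite integral_mkcond; apply: eq_integral => w _; rewrite patchE.
  case: (pselect (exists k, hits M goal w k)) => h.
    rewrite mem_set //; apply/esym/lim_near_cst => //; exists (ex_minn h) => // n /= hn.
    rewrite /f since_goal_prefix; case: pselect => // h'.
    by rewrite (Prop_irrelevance h' h) hn.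
  rewrite memNset //; apply/esym/lim_near_cst => //; exists 0%N => // n _.
  by rewrite /f since_goal_prefix; case: pselect.
rewrite monotone_convergence //; first last.
- by move=> n w _; rewrite lee_fin.
- by move=> n; apply/measurable_EFinP; exact: measurable_prefix.
have -> : (fun n => \int[Pr sigma s]_w f n w)%E =
          (fun n => (ev sigma n (at_goal g) (s, [::]))%:E).
  apply/funext => n; rewrite integral_prefix //; congr EFin.
  by apply/le_anti; rewrite !le_ev // => p pP _; rewrite since_goalE.
apply/cvg_lim => //; apply: ereal_nondecreasing_cvgn.
have -> : (fun n => (ev sigma n (at_goal g) (s, [::]))%:E) =
          (fun n => \int[Pr sigma s]_w f n w)%E.
  apply/funext => n; rewrite integral_prefix //; congr EFin.
  by apply/le_anti; rewrite !le_ev // => p pP _; rewrite since_goalE.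
move=> m n mn; apply: ge0_le_integral => //.
- by move=> w _; rewrite lee_fin.
- by apply/measurable_EFinP; exact: measurable_prefix.
- by apply/measurable_EFinP; exact: measurable_prefix.
- by move=> w _; exact: f_nd.
Qed.

Lemma measurable_reach : measurable (reach M goal : set (runs M)).
Proof.
have -> : reach M goal = \bigcup_n [set w : runs M | hits M goal w n].
  by apply/seteqP; split=> w /= [n]; exists n.
apply: bigcup_measurable => n _.
have -> : [set w : runs M | hits M goal w n] = [set: runs M] `&`
    (fun w => ((last_st (Defs.prefix w n) == goal)%:R : R)) @^-1` [set 1].
  rewrite setTI; apply/seteqP; split=> w /=; rewrite /hits; first by move=> ->.
  by case: eqP => //= _ /eqP; rewrite eq_sym oner_eq0.
have mF : measurable_fun [set: runs M] (fun w => ((last_st (Defs.prefix w n) == goal)%:R : R)).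
  exact: (@measurable_prefix R S Act M n (fun p => (last_st p == goal)%:R)).
exact: mF.
Qed.

End Reach.

(* The expectation of the reward k (W - theta), where W is the weight at the
   goal, over the runs reaching the goal within n steps. *)
Definition goal_ev (R : realType) (S Act : finType) (M : mdp S Act) (goal : S)
    (sigma : scheduler R M) (theta : R) n (k : R -> R) : R :=
  ev sigma n (at_ M theta (on_goal goal k)) (init M, [::]).

Section ConditionalValue.
Local Open Scope classical_set_scope.
Variables (R : realType) (S Act : finType) (M : mdp S Act) (goal : S).
Hypothesis goal_absorbing : absorbing M goal.
Variables (sigma : scheduler R M) (theta : R).
Implicit Types (n : nat) (e : R).

Let i0 : fin_path S Act := (init M, [::]).
Local Notation E := (goal_ev goal sigma theta).

Lemma goal_ev_lin n (k l : R -> R) a b : E n (fun y => a * k y + b * l y) = a * E n k + b * E n l.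
Proof.
rewrite /goal_ev -ev_lin; apply: eq_ev => p; rewrite /at_ /on_goal.
by case: ifP => _ //; rewrite !mulr0 addr0.
Qed.

Lemma goal_ev_le n k l : (forall y, k y <= l y) -> E n k <= E n l.
Proof. by move=> kl; apply: le_ev_at => // s w; rewrite /on_goal; case: ifP. Qed.

Lemma goal_ev_nd k : (forall y, 0 <= k y) -> {homo E^~ k : m n / (m <= n)%N >-> m <= n}.
Proof. by move=> k0 m n; apply: le_ev_on_goal. Qed.

Lemma goal_ev1 n : 0 <= E n (fun=> 1) <= 1.
Proof.
have E0 : ev sigma n (fun=> 0) i0 = 0 by apply: ev_cst.
have E1 : ev sigma n (fun=> 1) i0 = 1 by apply: ev_cst.
apply/andP; split; [rewrite -[leLHS]E0|rewrite -[leRHS]E1];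
  by apply: le_ev => // p _ _; rewrite /at_ /on_goal; case: ifP.
Qed.

Let E1_bounded : exists k, forall n, E n (fun=> 1) <= k.
Proof. by exists 1 => n; case/andP: (goal_ev1 n). Qed.

Let posw (y : R) : R := Num.max (y + theta) 0.
Let negw (y : R) := negp (y + theta).

Let prob_reach : Pr sigma (init M) (reach M goal) = ereal_sup (range (fun n => (E n (fun=> 1))%:E)).
Proof.
rewrite -(integral_reach goal_absorbing sigma (init M) (g := fun=> 1)) //.
transitivity (\int[Pr sigma (init M)]_(w in reach M goal) (cst 1%E w))%E.
  by rewrite integral_cst ?mul1e //; exact: measurable_reach.
by apply: eq_integral => w; rewrite inE => wr; case: pselect.
Qed.

Let int_acc :
  (\int[Pr sigma (init M)]_(w in reach M goal) (acc_wgt R M goal w)%:E)%E =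
  (ereal_sup (range (fun n => (E n posw)%:E)) - ereal_sup (range (fun n => (E n negw)%:E)))%E.
Proof.
have aE (k : R -> R) n : E n (fun y => k (y + theta)) =
    ev sigma n (at_goal M goal (fun z => k z%:~R)) i0.
  apply: eq_ev => p; rewrite /at_ /on_goal /at_goal /excess.
  by case: ifP => // _; rewrite subrK.
rewrite integralE; congr (_ - _)%E.
  under [in RHS]eq_fun do rewrite (aE (fun y => Num.max y 0)).
  rewrite -(integral_reach goal_absorbing) => [|z]; last by rewrite le_max lexx orbT.
  apply: eq_integral => w _; rewrite funeposE -EFin_max /acc_wgt.
  by case: pselect => // h; rewrite maxxx.
under [in RHS]eq_fun do rewrite (aE negp).
rewrite -(integral_reach goal_absorbing) => [|z]; last exact: negp_ge0.
apply: eq_integral => w _; rewrite funenegE -EFinN -EFin_max /acc_wgt.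
by case: pselect => // h; rewrite oppr0 maxxx.
Qed.

Let sup_real u : {homo u : m n / (m <= n)%N >-> m <= n} -> (exists k, forall n, u n <= k) ->
  exists l : R, [/\ ereal_sup (range (fun n => (u n)%:E)) = l%:E,
    forall n, u n <= l & forall e, 0 < e -> exists N, forall n, (N <= n)%N -> l - e <= u n].
Proof.
move=> u_nd [k uk]; have ub : has_ubound (range u) by exists k => _ [n _ <-].
have ne : range u !=set0 by exists (u 0%N), 0%N.
exists (sup (range u)); split.
- rewrite -ereal_sup_EFin //; congr ereal_sup; apply/seteqP; split=> x /=.
    by move=> [n _ <-]; exists (u n) => //; exists n.
  by move=> [_ [n _ <-] <-]; exists n.
- by move=> n; apply: ub_le_sup => //; exists n.
move=> e e0; have [_ [N _ <-] uN] := sup_adherent e0 (conj ne ub).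
by exists N => n Nn; apply: le_trans (ltW uN) (u_nd _ _ Nn).
Qed.

Lemma excess_le p : `|excess M theta p| <= wmax R M * (size p.2)%:R + `|theta|.
Proof.
suff : `|(path_wgt M p)%:~R : R| <= wmax R M * (size p.2)%:R.
  by move=> H; apply: le_trans (ler_normB _ _) _; rewrite lerD2r.
case: p => s h; elim/last_ind: h => [|h u IH]; first by rewrite normr0 mulr0.
rewrite -[(s, rcons h u)]/(extend (s, h) u) wgt_extend size_extend rmorphD /=.
apply: le_trans (ler_normD _ _) _; rewrite mulrS mulrDr mulr1 addrC lerD //.
by rewrite ler_norml; exact: wt_le.
Qed.

Lemma prob_reach_gt0 n : 0 < E n (fun=> 1) ->
  (0 < Pr sigma (init M) (reach M goal))%E.
Proof.
move=> En; rewrite prob_reach; apply: lt_le_trans (ereal_sup_ubound _); last by exists n.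
by rewrite lte_fin.
Qed.

(** Within n steps the reward is at most a constant B, so its expectation is at most B times the
    probability of having reached the goal. *)
Lemma goal_ev_id_gt0 n : 0 < E n id -> 0 < E n (fun=> 1).
Proof.
move=> En; pose B := wmax R M * n%:R + `|theta|.
have EB : E n id <= B * E n (fun=> 1).
  apply: le_trans (_ : E n (fun=> B * 1 + 0 * 1) <= _); last first.
    by rewrite goal_ev_lin mul0r addr0.
  apply: le_ev => // p _ /= sp; rewrite /at_ /on_goal; case: ifP => // _.
  rewrite mulr1 mul0r addr0; apply: le_trans (ler_norm _) _.
  by have := excess_le p; rewrite sp.
rewrite lt_neqAle eq_sym; have /andP[-> _] := goal_ev1 n; rewrite andbT.
by apply/eqP => E0; move: EB; rewrite E0 mulr0 leNgt En.
Qed.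

Lemma CE_unbounded : (0 < Pr sigma (init M) (reach M goal))%E ->
  (forall k, exists n, k < E n negp) -> CE goal sigma = -oo%E.
Proof.
move=> p0 nb; rewrite /CE /cond_expectation int_acc.
have -> : ereal_sup (range (fun n => (E n negw)%:E)) = +oo%E.
  apply/eqyP => A A0; have [n An] := nb (A + `|theta|).
  apply: le_trans (ereal_sup_ubound _); last by exists n.
  rewrite lee_fin -(lerD2r `|theta|); apply: le_trans (ltW An) _.
  apply: le_trans (_ : E n (fun y => 1 * negw y + `|theta| * 1) <= _).
    apply: goal_ev_le => y; rewrite mul1r mulr1 /negw; apply: negp_le.
      have := negp_geN (y + theta); have := ler_norm theta; lra.
    by rewrite addr_ge0 ?negp_ge0.
  by rewrite goal_ev_lin mul1r lerD2l ler_piMr //; case/andP: (goal_ev1 n).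
have pf : Pr sigma (init M) (reach M goal) \is a fin_num.
  by apply: fin_num_measure; exact: measurable_reach.
(* Adding [-oo] to anything, even to [+oo], gives [-oo], so the positive part need not be
   examined. *)
rewrite [X in (_ + X)%E]/= addeNy gt0_mulNye //; move: p0; rewrite -(fineK pf) lte_fin => p0.
by rewrite inver gt_eqF // lte_fin invr_gt0.
Qed.

Hypothesis neg_bounded : exists k, forall n, E n negp <= k.

Let negw_bounded : exists k, forall n, E n negw <= k.
Proof.
have [k nk] := neg_bounded; exists (k + `|theta|) => n.
apply: le_trans (_ : E n (fun y => 1 * negp y + `|theta| * 1) <= _).
  apply: goal_ev_le => y; rewrite mul1r mulr1 /negw; apply: negp_le.
    have := negp_geN y; have := ler_norm (- theta); rewrite normrN; lra.
  by rewrite addr_ge0 ?negp_ge0.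
by rewrite goal_ev_lin mul1r lerD ?nk // ler_piMr //; case/andP: (goal_ev1 n).
Qed.

Let E_id n : E n id = E n posw - E n negw - theta * E n (fun=> 1).
Proof.
transitivity (E n (fun y => 1 * (1 * posw y + -1 * negw y) + (- theta) * 1)).
  congr (ev _ _ _ _); apply/funext => p; congr (at_ _ _ _ _); apply/funext => s.
  apply/funext => y; rewrite /on_goal; case: ifP => // _; rewrite /posw /negw /negp.
  by case: (lerP (y + theta) 0); case: (lerP (- (y + theta)) 0); lra.
by rewrite !goal_ev_lin; ring.
Qed.

Variable v : R.

Let ge_arith (x y z b r d e : R) : b - d <= y -> v - d <= x - y - theta * z ->
  d * (`|theta| + 2) = e -> theta * (r - z) <= `|theta| * d ->
  v + theta * r + b <= x + e.
Proof. by move=> bE vE <- H; lra. Qed.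

Let le_arith (x y z b r d e : R) : y <= b -> x - y - theta * z <= v + d ->
  d * (`|theta| + 2) = e -> theta * (z - r) <= `|theta| * d ->
  0 < d -> x <= v + theta * r + b + e.
Proof. by move=> yb vE <- H d0; lra. Qed.

Lemma integral_ge : (forall e, 0 < e -> exists N, forall n, (N <= n)%N -> v - e <= E n id) ->
  (v%:E + theta%:E * Pr sigma (init M) (reach M goal) <=
   \int[Pr sigma (init M)]_(w in reach M goal) (acc_wgt R M goal w)%:E)%E.
Proof.
move=> vE; rewrite int_acc prob_reach.
have [r [-> rn rl]] := @sup_real (E^~ (fun=> 1)) (goal_ev_nd (fun _ => ler01))
  E1_bounded.
have [b [-> bn bl]] := @sup_real (E^~ negw) (goal_ev_nd (fun _ => negp_ge0 _)) negw_bounded.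
set A := ereal_sup _.
have An n : ((E n posw)%:E <= A)%E by apply: ereal_sup_ubound; exists n.
rewrite leeBrDr // -!EFinM -!EFinD; apply/lee_addgt0Pr => e e0.
(* The approximations of [v] and of the negative part cost [d] each, that of the reachability
   probability costs [|theta| * d]. *)
pose d := e / (`|theta| + 2).
have t0 := normr_ge0 theta.
have d0 : 0 < d by rewrite divr_gt0 //; lra.
have dE : d * (`|theta| + 2) = e by rewrite /d divfK //; lra.
have [N1 vN] := vE d d0; have [N2 rN] := rl d d0; have [N3 bN] := bl d d0.
pose n := maxn N1 (maxn N2 N3).
have := vN n (leq_maxl _ _); have := rN n _; have := bN n _.
rewrite !leq_max !leqnn !orbT => /(_ isT) bE /(_ isT) rE; rewrite E_id => vE'.
apply: le_trans (leeD (An n) (lexx e%:E)); rewrite -EFinD lee_fin.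
have : theta * (r - E n (fun=> 1)) <= `|theta| * d.
  apply: le_trans (ler_norm _) _; rewrite normrM ler_wpM2l // ger0_norm; have := rn n; lra.
exact: ge_arith bE vE' dE.
Qed.

Lemma integral_le : (forall e, 0 < e -> exists N, forall n, (N <= n)%N -> E n id <= v + e) ->
  (\int[Pr sigma (init M)]_(w in reach M goal) (acc_wgt R M goal w)%:E <=
   v%:E + theta%:E * Pr sigma (init M) (reach M goal))%E.
Proof.
move=> vE; rewrite int_acc prob_reach.
have [r [-> rn rl]] := @sup_real (E^~ (fun=> 1)) (goal_ev_nd (fun _ => ler01))
  E1_bounded.
have [b [-> bn bl]] := @sup_real (E^~ negw) (goal_ev_nd (fun _ => negp_ge0 _)) negw_bounded.
rewrite leeBlDr // -!EFinM -!EFinD; apply: ge_ereal_sup => _ [m _ <-].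
rewrite lee_fin; apply/ler_addgt0Pr => e e0.
pose d := e / (`|theta| + 2).
have t0 := normr_ge0 theta.
have d0 : 0 < d by rewrite divr_gt0 //; lra.
have dE : d * (`|theta| + 2) = e by rewrite /d divfK //; lra.
have [N1 vN] := vE d d0; have [N2 rN] := rl d d0.
pose n := maxn m (maxn N1 N2).
have mn : E m posw <= E n posw.
  by apply: goal_ev_nd (leq_maxl _ _) => y; rewrite le_max lexx orbT.
have := vN n _; have := rN n _.
rewrite !leq_max !leqnn !orbT => /(_ isT) rE /(_ isT); rewrite E_id => vE'.
have : theta * (E n (fun=> 1) - r) <= `|theta| * d.
  apply: le_trans (ler_norm _) _; rewrite normrM ler_wpM2l // distrC ger0_norm; have := rn n; lra.
move=> H; apply: le_trans mn _; exact: le_arith (bn n) vE' dE H d0.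
Qed.

Lemma CE_ge : (0 < Pr sigma (init M) (reach M goal))%E -> 0 <= v ->
  (forall e, 0 < e -> exists N, forall n, (N <= n)%N -> v - e <= E n id) ->
  (theta%:E <= CE goal sigma)%E /\ (0 < v -> (theta%:E < CE goal sigma)%E).
Proof.
move=> p0 v0 /integral_ge; rewrite /CE /cond_expectation.
have pf : Pr sigma (init M) (reach M goal) \is a fin_num.
  by apply: fin_num_measure; exact: measurable_reach.
move: p0; rewrite -(fineK pf) lte_fin => p0 H.
rewrite inver gt_eqF // lee_pdivlMr // lte_pdivlMr //; split=> [|v1].
  by apply: le_trans H; rewrite leeDr // lee_fin.
by apply: lt_le_trans H; rewrite lteDr // lte_fin.
Qed.

End ConditionalValue.

(** Integrability of the negative part may be assumed when bounding the expectations, because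
    without it the conditional expectation is [-oo]. *)
Lemma CE_le (R : realType) (S Act : finType) (M : mdp S Act) (goal : S)
    (sigma : scheduler R M) (theta : R) : absorbing M goal ->
  (0 < Pr sigma (init M) (reach M goal))%E ->
  ((exists k, forall n, goal_ev goal sigma theta n negp <= k) ->
   forall e, 0 < e -> exists N, forall n, (N <= n)%N -> goal_ev goal sigma theta n id <= e) ->
  (CE goal sigma <= theta%:E)%E.
Proof.
move=> gA p0 H; have [nb|] := pselect (exists k, forall n, goal_ev goal sigma theta n negp <= k).
  have : forall e, 0 < e -> exists N, forall n, (N <= n)%N ->
      goal_ev goal sigma theta n id <= 0 + e.
    by move=> e e0; have [N NP] := H nb e e0; exists N => n; rewrite add0r; exact: NP.
  move=> /(integral_le gA nb); rewrite add0e /CE /cond_expectation.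
  have pf : Pr sigma (init M) (reach M goal) \is a fin_num.
    by apply: fin_num_measure; exact: measurable_reach.
  move: p0; rewrite -(fineK pf) lte_fin => p0.
  by rewrite inver gt_eqF // lee_pdivrMr.
move/forallNP => nb; rewrite (CE_unbounded gA p0 (theta := theta)) ?leNye // => k.
by have /existsNP[n /negP] := nb k; rewrite -ltNge; exists n.
Qed.

(** * The value function *)

Section Value.
Variables (R : realType) (S Act : finType) (M : mdp S Act) (goal : S).
Hypothesis goal_absorbing : absorbing M goal.
Implicit Types (s t : S) (a : Act) (x y z : R) (n : nat).

Local Notation loss := (@loss R S Act M goal).
Local Notation stop := (@stop R S Act M goal).
Local Notation forced := (forced M goal).

Lemma stop_ge s y : - loss s y <= stop s y.
Proof.
rewrite /stop; case: ifP => // sg; rewrite /loss sg.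
by rewrite lerNl negp_geN.
Qed.

Lemma stop_safe s y : s \notin forced -> stop s y = 0.
Proof.
move=> sF; rewrite /stop /loss (negPf sF); case: eqP => [sg|_]; last by rewrite oppr0.
by move: sF; rewrite sg goal_forced.
Qed.

Lemma stop_lower : exists k, 0 <= k /\ forall s y, - (negp y + k) <= stop s y.
Proof.
have [k [k0 kl]] := loss_le R M goal; exists k; split=> // s y.
by apply: le_trans (stop_ge s y); rewrite lerN2.
Qed.

Lemma stop_shift s y z : 0 <= z -> stop s y <= stop s (y + z) <= stop s y + z.
Proof.
move=> z0; have H : negp y - z <= negp (y + z) <= negp y.
  apply/andP; split; last first.
    by apply: negp_le (negp_ge0 _); have := negp_geN y; lra.
  rewrite lerBlDr; apply: negp_le; last by rewrite addr_ge0 ?negp_ge0.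
  have := negp_geN (y + z); lra.
case/andP: H => h1 h2; rewrite /stop /loss; case: (s == goal); first lra.
by case: (s \in forced); lra.
Qed.

Lemma stop_step s a y : a \in enabled M s ->
  (s \notin forced -> forall t, 0 < tr M s a t -> t \notin forced) ->
  stop s y <= step M stop s a y.
Proof.
move=> aE safe; have [sg|sg] := eqVneq s goal.
  by rewrite absorbing_step // sg.
rewrite {1}/stop (negPf sg); have := loss_step goal_absorbing y aE safe.
rewrite -lerN2 => /le_trans-> //.
have -> : - step M loss s a y = step M (fun u x => -1 * loss u x + 0) s a y.
  by rewrite step_affine // addr0 mulN1r.
by apply: le_step => t _; rewrite mulN1r addr0 stop_ge.
Qed.

Lemma safe_actP s : exists a, a \in enabled M s /\
  (s \notin forced -> forall t, 0 < tr M s a t -> t \notin forced).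
Proof.
have [sF|sF] := boolP (s \in forced).
  by exists (some_act M s); split=> //; exact: some_act_enabled.
by have [a aE aF] := safe_succ sF; exists a.
Qed.

Variable theta : R.
Hypothesis CE_le_theta : forall sigma : scheduler R M,
  (0 < Pr sigma (init M) (reach M goal))%E -> (CE goal sigma <= theta%:E)%E.

(* The scheduler is greedy for n steps and safe afterwards.  As the negative
   part of its reward is integrable, a positive value would give it a
   conditional expectation above theta. *)
Lemma viter_init n : viter M stop n (init M) (- theta) <= 0.
Proof.
pose value (p : fin_path S Act) := viter M stop (n - size p.2) (last_st p) (excess M theta p).
have /choice[pol polP] : forall p : fin_path S Act, exists a, a \in enabled M (last_st p) /\
    value p <= step M (viter M stop (n - (size p.2).+1)) (last_st p) a (excess M theta p) /\
    ((n <= size p.2)%N -> last_st p \notin forced ->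
      forall t, 0 < tr M (last_st p) a t -> t \notin forced).
  move=> p; rewrite /value; set y := excess _ _ _; have [b [bE bsafe]] := safe_actP (last_st p).
  have [np|pn] := leqP n (size p.2).
    (* Past the horizon both truncated subtractions vanish, and [value] is just [stop]. *)
    rewrite (eqnP (_ : n - size p.2 == 0)%N) // (eqnP (_ : n - (size p.2).+1 == 0)%N); last first.
      by rewrite subn_eq0 leqW.
    by exists b; split=> //; split=> //; exact: stop_step.
  rewrite -[(n - size p.2)%N]prednK ?subn_gt0 // -subnS.
  have [a aE ab] := bestP M (last_st p)
    (fun a => step M (viter M stop (n - (size p.2).+1)) (last_st p) a y).
  exists a; split=> //; split=> // ; rewrite -ab viterS ge_max lexx andbT.
  (* Stopping is no better than the safe action [b], so the maximum is attained by continuing. *)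
  apply: le_trans (best_ge _ bE); apply: le_trans (stop_step y bE bsafe) _.
  by apply: le_step => t _; exact: viter_ge.
have polE p : pol p \in enabled M (last_st p) by have [] := polP p.
pose sigma := det_scheduler R polE.
have i0P : is_path M (init M, [::]) by [].
have lossS : forall q, is_path M q -> (n <= size q.2)%N ->
    ev sigma 1 (at_ M theta loss) q <= at_ M theta loss q.
  move=> q _ nq; rewrite det_ev1 at_step; apply: loss_step => //.
  by have [_ [_]] := polP q; apply.
have neg_bounded : exists k, forall m, goal_ev goal sigma theta m negp <= k.
  exists (ev sigma n (at_ M theta loss) (init M, [::])) => m.
  apply: le_trans (goal_ev_nd goal_absorbing sigma theta (@negp_ge0 R) (leq_addl n m)) _.
  apply: le_trans (_ : ev sigma (n + m) (at_ M theta loss) (init M, [::]) <= _).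
    apply: le_ev_at => // s w; rewrite /on_goal; case: ifP => [sg|_]; last exact: loss_ge0.
    by rewrite /loss sg.
  rewrite ev_add; apply: le_ev => // q qP sq; apply: ev_super => // r rP sr.
  by apply: lossS => //; apply: leq_trans sr; rewrite sq leq_addl.
rewrite leNgt; apply/negP; set v := viter _ _ _ _ _ => v0.
have id_ge m : (n <= m)%N -> v <= goal_ev goal sigma theta m id.
  move=> nm; apply: le_trans (_ : ev sigma m value (init M, [::]) <= _).
    have -> : v = value (init M, [::]).
      by rewrite /value subn0 /v /excess /path_wgt /= sub0r.
    apply: ev_sub => // q qP _; rewrite det_ev1.
    have [_ [H _]] := polP q; apply: le_trans H _; rewrite le_eqVlt; apply/orP; left.
    apply/eqP; apply: eq_bigr => t _.
    by rewrite /value last_extend size_extend /excess wgt_extend rmorphD addrAC.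
  apply: le_ev => // q _ /= sq; rewrite /value sq.
  rewrite (eqnP (_ : n - m == 0)%N); last by rewrite subn_eq0.
  rewrite /at_ /on_goal /viter /stop; case: ifP => // _.
  by rewrite oppr_le0 loss_ge0.
have p0 := prob_reach_gt0 goal_absorbing (goal_ev_id_gt0 (lt_le_trans v0 (id_ge n (leqnn n)))).
have [|_ /(_ v0)] := CE_ge goal_absorbing neg_bounded p0 (ltW v0).
  move=> e e0; exists n => m nm; apply: le_trans (id_ge _ nm); rewrite gerBl; exact: ltW.
by rewrite ltNge CE_le_theta.
Qed.

Lemma viter_stop_shift n s y z : 0 <= z ->
  viter M stop n s y <= viter M stop n s (y + z) <= viter M stop n s y + z.
Proof.
move=> z0; apply/andP; split.
  (* Monotonicity is the shift by [- z] applied at [y + z]. *)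
  have := @viter_shift R S Act M stop 1 0 (- z) ler01 (lexx 0).
  move=> /(_ _ n s (y + z)); rewrite addrK mul1r addr0; apply=> t x.
  by rewrite mul1r addr0; have /andP[+ _] := stop_shift t (x - z) z0; rewrite subrK.
have := @viter_shift R S Act M stop 1 z z ler01 z0.
move=> /(_ _ n s y); rewrite mul1r; apply=> t x.
by rewrite mul1r; have /andP[] := stop_shift t x z0.
Qed.

(* Every state is reachable from init, and the value is 1-Lipschitz in y. *)
Lemma viter_stop_bounded : bounded_viter M stop.
Proof.
suff H s : exists y k, forall n, viter M stop n s y <= k.
  move=> s y; have [x [k xk]] := H s; exists (k + Num.max (y - x) 0) => n.
  have [xy|yx] := lerP 0 (y - x).
    have /andP[_] := viter_stop_shift n s x xy; rewrite addrC subrK => /le_trans-> //.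
    by rewrite lerD2r.
  have xy : 0 <= x - y by lra.
  have /andP[yx1 _] := viter_stop_shift n s y xy; rewrite addrC subrK in yx1.
  by rewrite addr0 (le_trans yx1).
have /connectP[h hP ->] := tr_reachable M s.
have : exists y k, forall n, viter M stop n (init M) y <= k.
  by exists (- theta), 0; exact: viter_init.
elim: h (init M) hP => [|t h IH] u //= /andP[/existsP[a p0] hP] [y [k yk]].
apply: IH hP _; have aE := tr_gt0_enabled p0.
have [l [l0 ll]] := stop_lower.
pose x := y + weight R M u a.
(* The bound at [u] is solved for the term of [t], the other successors being bounded below by
   [stop_lower]. *)
exists x, ((k - - (negp x + l)) / prob R M u a t + - (negp x + l)) => n.
have pr0 : 0 < prob R M u a t by rewrite prob_gt0.
rewrite -lerBlDr ler_pdivlMr // mulrC lerBrDr; apply: le_trans (yk n.+1).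
apply: le_trans (step_viter _ _ _ aE); apply: step_ge_term => // v _.
by apply: le_trans (ll v _) (viter_ge _ _ _ _ _).
Qed.

(* value s y is the supremum of the expectation of W - theta on the runs that
   reach the goal, from s with current weight y + theta. *)
Definition value : S -> R -> R := env M stop.

Lemma value_super : superharmonic M value.
Proof. exact: env_super viter_stop_bounded. Qed.

Lemma value_ge s y : stop s y <= value s y.
Proof. exact: env_ge viter_stop_bounded _ _. Qed.

Lemma value_safe s y : s \notin forced -> 0 <= value s y.
Proof. by move=> sF; rewrite -(stop_safe y sF) value_ge. Qed.

Lemma value_lower : exists k, 0 <= k /\ forall s y, - (negp y + k) <= value s y.
Proof.
have [k [k0 kl]] := stop_lower; exists k; split=> // s y.
exact: le_trans (kl s y) (value_ge s y).
Qed.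

Lemma value_goal y : value goal y = y.
Proof.
apply/le_anti; have := value_ge goal y; rewrite {1}/stop eqxx => ->; rewrite andbT.
apply: env_le => n; elim: n => [|n IH]; first by rewrite /viter /stop eqxx.
rewrite viterS ge_max {1}/stop eqxx lexx /=; apply: best_le => a aE.
by rewrite absorbing_step.
Qed.

Lemma value_conserving s y :
  exists2 a, a \in enabled M s & step M value s a y = value s y.
Proof.
apply: (env_conserving viter_stop_bounded); have [a [aE asafe]] := safe_actP s.
by exists a => //; exact: stop_step.
Qed.

Lemma value_shift s y z : 0 <= z -> value s y <= value s (y + z) <= value s y + z.
Proof.
move=> z0; apply/andP; split; apply: env_le => n.
  have /andP[H _] := viter_stop_shift n s y z0; apply: le_trans H _.
  exact: viter_le_env viter_stop_bounded _ _ _.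
have /andP[_ H] := viter_stop_shift n s y z0; apply: le_trans H _.
by rewrite lerD2r; exact: viter_le_env viter_stop_bounded _ _ _.
Qed.

Lemma value_init : value (init M) (- theta) <= 0.
Proof. by apply: env_le => n; exact: viter_init. Qed.

Lemma le_value s x y : x <= y -> value s x <= value s y.
Proof.
rewrite -subr_ge0 => xy; have /andP[] := value_shift s x xy.
by rewrite addrC subrK.
Qed.

(** A fixed path to the goal has positive probability and its reward grows with y, while at high
    weights the other branches lose at most a constant [l]. Each step of the path asks its successor
    for the larger target [(k + l) / prob - l]. *)
Lemma value_infty s k : reachable M s goal ->
  exists x, forall y, x <= y -> k <= value s y.
Proof.
move=> /connectP[h hP hg]; elim: h s hP hg k => [|t h IH] s /=.
  by move=> _ <- k; exists k => y; rewrite value_goal.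
move=> /andP[/existsP[a p0] hP] hg k; have aE := tr_gt0_enabled p0.
have pr0 : 0 < prob R M s a t by rewrite prob_gt0.
have [l [l0 ll]] := value_lower.
have [x xk] := IH t hP hg ((k + l) / prob R M s a t - l).
have wm := wt_le R M s a; exists (Num.max x 0 + wmax R M) => y xy.
have /andP[mx m0] : (x <= Num.max x 0) && (0 <= Num.max x 0).
  by rewrite !le_max !lexx orbT.
apply: le_trans (value_super _ aE).
apply: le_trans (step_ge_term (k := - l) aE p0 _) => [|u _]; last first.
  apply: le_trans (ll u _); rewrite lerN2 -[leRHS]add0r lerD2r.
  by apply: negp_le => //; lra.
have /(ler_wpM2l (ltW pr0)) : (k + l) / prob R M s a t <= value t (y + weight R M s a) - - l.
  by rewrite opprK -lerBlDr; apply: xk; lra.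
by rewrite mulrC divfK ?gt_eqF //; lra.
Qed.

End Value.

(** * Exponential decay of the probability of high weights *)

Section Lyapunov.
Variables (R : realType) (S Act : finType) (M : mdp S Act) (goal : S).
Hypothesis goal_absorbing : absorbing M goal.
Hypothesis fail_unique : fail_collapsed M goal.
Variable theta : R.
Hypothesis CE_le_theta : forall sigma : scheduler R M,
  (0 < Pr sigma (init M) (reach M goal))%E -> (CE goal sigma <= theta%:E)%E.
Implicit Types (s t : S) (a : Act) (x y z : R) (n : nat).

Local Notation V := (@value R S Act M goal).
Local Notation wmax := (wmax R M).
Local Notation pmin := (pmin R M).

Definition level s y : R := (0 <= y)%R%:R.

(* The supremum of the probability that the weight reaches 0 from y. *)
Definition hit : S -> R -> R := env M level.

Lemma viter_level_itv n s y : 0 <= viter M level n s y <= 1.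
Proof.
apply/andP; split; first by apply: le_trans (viter_ge _ _ _ _ _); exact: ler0n.
apply: (viter_least (f := fun _ _ => 1)) => [t x|t a x aE]; first by rewrite lern1 leq_b1.
exact: step_le_cst.
Qed.

Lemma level_bounded : bounded_viter M level.
Proof. by move=> s y; exists 1 => n; case/andP: (viter_level_itv n s y). Qed.

Lemma hit_ge0 s y : 0 <= hit s y.
Proof. by apply: le_trans (env_ge level_bounded _ _); exact: ler0n. Qed.

Lemma hit_le1 s y : hit s y <= 1.
Proof. by apply: env_le => n; case/andP: (viter_level_itv n s y). Qed.

Lemma hit_super : superharmonic M hit.
Proof. exact: env_super level_bounded. Qed.

Lemma viter_le_hit n s y : viter M level n s y <= hit s y.
Proof. exact: viter_le_env level_bounded _ _ _. Qed.

Lemma hit1 s y : 0 <= y -> hit s y = 1.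
Proof.
move=> y0; apply/le_anti; rewrite hit_le1 /=.
by apply: le_trans (env_ge level_bounded _ _); rewrite /level y0.
Qed.

Lemma le_hit s x y : x <= y -> hit s x <= hit s y.
Proof.
move=> xy; have -> : x = y + (x - y) by rewrite addrC subrK.
rewrite -[leRHS]addr0 -[X in _ <= X + 0]mul1r; apply: (env_shift level_bounded) => // t z.
rewrite mul1r addr0 /level; case: (lerP 0 (z + (x - y))) => [zy|]; last by rewrite ler0n.
by rewrite (_ : 0 <= z) //; lra.
Qed.

Lemma hit_absorbing s y : absorbing M s -> y < 0 -> hit s y <= 0.
Proof.
move=> sA y0; have l0 : level s y <= 0 by rewrite /level (leNgt 0) y0.
apply: env_le; elim=> [|n IH] //; rewrite viterS ge_max l0; apply: best_le => a aE.
by rewrite absorbing_step.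
Qed.

Lemma hit_le s y k : level s y <= k ->
  (forall a, a \in enabled M s -> step M hit s a y <= k) -> hit s y <= k.
Proof.
move=> lk hk; apply: env_le => -[|n] //; rewrite viterS ge_max lk.
apply: best_le => a aE; apply: le_trans (hk a aE).
by apply: le_step => t _; exact: viter_le_hit.
Qed.

(** As only differences of weights matter to the dynamics, this says that from s every rise of the
    weight has supremal probability 1. *)
Let climbing s := forall y, hit s y = 1.

Lemma not_climbing : exists k rho, [/\ 0 <= k, 0 <= rho < 1 &
  forall s, ~ climbing s -> hit s (- k) <= rho].
Proof.
have /choice[h hP] : forall s, exists y, ~ climbing s -> hit s y < 1.
  move=> s; have [sC|/existsNP[y yh]] := pselect (climbing s); first by exists 0.
  by exists y => _; rewrite lt_neqAle hit_le1 andbT; apply/eqP.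
pose k := \sum_s `|h s|.
pose rho := \big[Num.max/0]_(s | `[< ~ climbing s >]) hit s (- k).
exists k, rho; split; first exact: sumr_ge0.
  rewrite bigmax_ge_id /=; apply: bigmax_lt => // s /asboolP sC.
  apply: le_lt_trans (hP s sC); apply: le_hit; rewrite lerNl /k (bigD1 s) //=.
  apply: le_trans (_ : `|h s| <= _); first by rewrite -normrN ler_norm.
  by rewrite lerDl sumr_ge0.
by move=> s sC; apply: (le_bigmax_cond 0 (fun s => hit s (- k))); exact/asboolP.
Qed.

(* From a climbing state the goal can be avoided, and arbitrarily high weights
   are reached with a probability bounded below while avoiding it.  Going for
   the goal only from there makes the value infinite. *)
Lemma no_climbing s : ~ climbing s.
Proof.
move=> s0C; have [k [rho [k0 /andP[rho0 rho1] hk]]] := not_climbing.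
have w0 := wmax_ge0 R M; have := pmin_itv R M => /andP[p0 p1].
(* At low weights, an action with a non-climbing successor misses level 0 with probability at least
   [eta]. A climbing state must therefore have an action with climbing successors only. *)
pose eta := pmin * (1 - rho).
have eta0 : 0 < eta by rewrite mulr_gt0 // subr_gt0.
have eta1 : eta <= 1 by rewrite mulr_ile1 // ?subr_ge0 ?gerBl // ltW.
have drop u a t y : a \in enabled M u -> 0 < tr M u a t -> ~ climbing t ->
    y <= - (k + wmax) -> step M hit u a y <= 1 - eta.
  move=> aE pt tC yk; apply: le_trans (step_le_term aE pt (fun u _ => hit_le1 _ _)) _.
  rewrite lerD2l lerN2 ler_wpM2l ?(ltW p0) // lerD2l lerN2.
  by apply: le_trans (hk t tC); apply: le_hit; have := wt_le R M u a; lra.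
have stay u : climbing u ->
    exists2 a, a \in enabled M u & forall t, 0 < tr M u a t -> climbing t.
  move=> uC; apply: contrapT => nstay.
  have : hit u (- (k + wmax) - 1) <= 1 - eta.
    apply: hit_le => [|a aE].
      by rewrite /level (leNgt 0) (_ : _ < 0) ?subr_ge0 //; lra.
    have [/= aC|/existsNP[t /not_implyP[pt tC]]] :=
        pselect (forall t, 0 < tr M u a t -> climbing t).
      by case: nstay; exists a.
    by apply: drop pt tC _ => //; lra.
  by rewrite uC; lra.
have gC : ~ climbing goal.
  move=> /(_ (-1)) h1; have := hit_absorbing goal_absorbing (y := -1).
  by rewrite h1; lra.
have safe u : climbing u -> u \notin forced M goal by exact: safe_coind gC stay u.
have reach_goal u : climbing u -> reachable M u goal.
  move=> uC; apply: contrapT => /negP nr; have uA := fail_unique.1 u nr.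
  by have := hit_absorbing uA (y := -1); rewrite uC; lra.
have V0 := value_safe goal_absorbing CE_le_theta.
pose beta := V s 0 + 1.
have beta0 : 0 < beta by rewrite /beta; have := V0 s 0 (safe s s0C); lra.
have /choice[h hP] : forall u, exists x, climbing u -> forall y, x <= y -> beta <= V u y.
  move=> u; have [uC|] := pselect (climbing u); last by exists 0.
  have [x xP] := value_infty goal_absorbing CE_le_theta beta (reach_goal u uC).
  by exists x.
pose r := \sum_u `|h u| + (k + wmax).
have rP u y : climbing u -> - (k + wmax) <= y -> beta <= V u (y + r).
  move=> uC yk; apply: hP => //; rewrite /r (bigD1 u) //=.
  have := ler_norm (h u); have : 0 <= \sum_(i | i != u) `|h i| by exact: sumr_ge0.
  lra.
(* The right-hand side is at least 1 once the weight is above the threshold, at least [1 - eta]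
   everywhere on climbing states, and superharmonic along actions that stay among them. At [y = - r]
   it yields [beta <= V s 0], against the choice of [beta]. *)
have bound n u y : climbing u ->
    viter M level n u y <= eta / beta * V u (y + r) + (1 - eta).
  have eb0 : 0 <= eta / beta by rewrite divr_ge0 // ltW.
  have near v x m : climbing v -> - (k + wmax) <= x ->
      viter M level m v x <= eta / beta * V v (x + r) + (1 - eta).
    move=> vC xk; apply: le_trans (_ : 1 <= _); first by have /andP[] := viter_level_itv m v x.
    suff : eta <= eta / beta * V v (x + r) by lra.
    by rewrite mulrAC ler_pdivlMr // ler_wpM2l ?(ltW eta0) // rP.
  elim: n u y => [|n IH] u y uC;
    have [yk|yk] := lerP (- (k + wmax)) y; do ?[exact: near];
    have eV : 0 <= eta / beta * V u (y + r) by rewrite mulr_ge0 // V0 ?safe.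
    apply: le_trans (_ : 0 <= _); first by rewrite /viter /level (leNgt 0) (_ : y < 0) //; lra.
    by rewrite addr_ge0 // subr_ge0.
  rewrite viterS ge_max; apply/andP; split.
    apply: le_trans (_ : 0 <= _); first by rewrite /level (leNgt 0) (_ : y < 0) //; lra.
    by rewrite addr_ge0 // subr_ge0.
  apply: best_le => a aE.
  have [aC|/existsNP[t /not_implyP[pt tC]]] :=
      pselect (forall t, 0 < tr M u a t -> climbing t).
    apply: le_trans (_ : step M (fun t x => eta / beta * V t (x + r) + (1 - eta)) u a y <= _).
      by apply: le_step => t /aC tC; exact: IH.
    rewrite (step_affine (fun t x => V t (x + r))) // lerD2r ler_wpM2l // -step_shift.
    exact: (value_super goal_absorbing CE_le_theta).
  apply: le_trans (_ : 1 - eta <= _); last by rewrite lerDr.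
  apply: le_trans (drop u a t y aE pt tC (ltW yk)).
  by apply: le_step => v _; exact: viter_le_hit.
have : hit s (- r) <= eta / beta * V s 0 + (1 - eta).
  by apply: env_le => n; have := bound n s (- r) s0C; rewrite addNr.
rewrite s0C; apply/negP; rewrite -ltNge.
have : eta / beta * V s 0 < eta; last by lra.
by rewrite mulrAC ltr_pdivrMr // ltr_pM2l // /beta; lra.
Qed.

(* L is the value of stopping with reward expR (kappa * y).  It is finite for
   small kappa: the weight rises by k with probability at most rho < 1. *)
Lemma lyapunov : exists kappa C (L : S -> R -> R), [/\ 0 < kappa, 0 < C,
  superharmonic M L & forall s y, expR (kappa * y) <= L s y <= C * expR (kappa * y)].
Proof.
have [k [rho [k0 /andP[rho0 rho1] hk]]] := not_climbing.
have {}hk s : hit s (- k) <= rho by apply: hk; exact: no_climbing.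
have w0 := wmax_ge0 R M.
pose l := k + wmax + 1; have l0 : 0 < l by rewrite /l; lra.
(* A factor with [1 < A] and [A * rho < 1]; [kappa] makes A the exponential growth over [l], which
   exceeds a rise by [k] plus the overshoot of one step. Solving [m <= A * (rho * m + 1)] gives the
   constant [2 / (1 - rho)]. *)
pose A := 2 / (1 + rho); have rp0 : 0 < 1 + rho by lra.
have A1 : 1 < A by rewrite /A ltr_pdivlMr // mul1r; lra.
have AE : A * (1 + rho) = 2 by rewrite /A divfK // gt_eqF.
pose kappa := ln A / l; have kappa0 : 0 < kappa by rewrite divr_gt0 // ln_gt0.
have expl : expR (kappa * l) = A by rewrite /kappa divfK ?gt_eqF // lnK // posrE; lra.
have le_expR x y : x <= y -> expR (kappa * x) <= expR (kappa * y).
  by move=> xy; rewrite ler_expR ler_pM2l.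
pose g (s : S) y := expR (kappa * y).
have gshift n s y z : viter M g n s (y + z) <= expR (kappa * z) * viter M g n s y.
  rewrite -[leRHS]addr0; apply: viter_shift => // t x; rewrite ?expR_ge0 //.
  by rewrite addr0 /g mulrDr expRD mulrC.
have g_ge0 n s y : 0 <= viter M g n s y.
  by apply: le_trans (viter_ge _ _ _ _ _); exact: expR_ge0.
have bound N : \big[Num.max/0]_s viter M g N s 0 <= 2 / (1 - rho).
  set m := \big[_/_]_s _.
  have m0 : 0 <= m by exact: bigmax_ge_id.
  have mN s : viter M g N s 0 <= m by exact: (le_bigmax 0 (fun s => viter M g N s 0)).
  have ew0 : 0 <= expR (kappa * wmax) * m by rewrite mulr_ge0 ?expR_ge0.
  (* Stopping below 0 earns at most 1; level 0 is passed by at most [wmax], and from there at most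
     [expR (kappa * wmax) * m] can be earned. Applied at [- k], where [hit] is at most [rho], this
     bounds [m] by itself; the horizon N is fixed so that [m] is finite beforehand. *)
  have H n s y : (n <= N)%N -> y <= wmax ->
      viter M g n s y <= expR (kappa * wmax) * m * hit s y + 1.
    elim: n s y => [|n IH] s y nN yw; have [y0|y0] := lerP 0 y.
    - rewrite hit1 // mulr1; apply: le_trans (_ : expR (kappa * wmax) * m <= _); last lra.
      rewrite -[y]add0r; apply: le_trans (gshift 0%N s 0 y) _.
      apply: ler_pM; [exact: expR_ge0|exact: g_ge0|exact: le_expR|].
      exact: le_trans (le_viter _ _ _ _ nN) (mN s).
    - rewrite /viter /g -[leLHS]add0r lerD ?mulr_ge0 ?hit_ge0 ?expR_ge0 //.
      by rewrite -[leRHS](@expR0 R) ler_expR pmulr_rle0 // ltW.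
    - rewrite hit1 // mulr1; apply: le_trans (_ : expR (kappa * wmax) * m <= _); last lra.
      rewrite -[y]add0r; apply: le_trans (gshift n.+1 s 0 y) _.
      apply: ler_pM; [exact: expR_ge0|exact: g_ge0|exact: le_expR|].
      exact: le_trans (le_viter _ _ _ _ nN) (mN s).
    rewrite viterS ge_max; apply/andP; split.
      rewrite /g -[leLHS]add0r lerD ?mulr_ge0 ?hit_ge0 ?expR_ge0 //.
      by rewrite -[leRHS](@expR0 R) ler_expR pmulr_rle0 // ltW.
    apply: best_le => a aE.
    apply: le_trans (_ : step M (fun t x => expR (kappa * wmax) * m * hit t x + 1) s a y <= _).
      apply: le_step => t _; apply: IH; first exact: ltnW.
      by have := wt_le R M s a; lra.
    by rewrite step_affine // lerD2r ler_wpM2l // hit_super.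
  have mA : m <= A * (rho * m + 1).
    apply: bigmax_le => [|s _].
      have A0 : 0 <= A by exact: le_trans ler01 (ltW A1).
      by rewrite mulr_ge0 // addr_ge0 // mulr_ge0.
    rewrite -{1}[0](addNr k); apply: le_trans (gshift N s (- k) k) _.
    apply: le_trans (_ : expR (kappa * k) * (expR (kappa * wmax) * m * rho + 1) <= _).
      rewrite ler_wpM2l ?expR_ge0 //; apply: le_trans (H N s (- k) _ _) _ => //; first lra.
      by rewrite lerD2r ler_wpM2l.
    rewrite mulrDr mulr1 mulrDr mulr1 lerD //; last first.
      by rewrite -expl le_expR // /l; lra.
    have -> : expR (kappa * k) * (expR (kappa * wmax) * m * rho) =
        expR (kappa * (k + wmax)) * (rho * m) by rewrite mulrDr expRD; ring.
    rewrite ler_wpM2r ?mulr_ge0 //.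
    by rewrite -expl le_expR // /l; lra.
  rewrite ler_pdivlMr ?subr_gt0 //.
  have := ler_wpM2r (ltW rp0) mA; rewrite mulrAC AE; lra.
have gB n s y : viter M g n s y <= 2 / (1 - rho) * expR (kappa * y).
  rewrite -[y in leLHS]add0r; apply: le_trans (gshift n s 0 y) _.
  rewrite mulrC ler_wpM2r ?expR_ge0 //; apply: le_trans (bound n).
  exact: (le_bigmax 0 (fun s => viter M g n s 0)).
have gbounded : bounded_viter M g by move=> s y; exists (2 / (1 - rho) * expR (kappa * y)).
exists kappa, (2 / (1 - rho)), (env M g); split=> //.
- by rewrite divr_gt0 // subr_gt0.
- exact: env_super.
move=> s y; rewrite (env_ge gbounded) /=; exact: env_le.
Qed.

(* V is sublinear at +oo, hence negligible against the Lyapunov function at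
   both ends. *)
Lemma value_lyapunov : exists L : S -> R -> R, [/\ superharmonic M L,
  forall s y, 0 <= L s y, exists C, forall s y, Num.max y 0 <= C * L s y &
  forall e, 0 < e -> exists x, forall s y, x <= `|y| -> V s y <= e * (L s y + 1)].
Proof.
have [kappa [C [L [k0 C0 LS Lexp]]]] := lyapunov.
have L0 s y : 0 <= L s y by have /andP[+ _] := Lexp s y; apply: le_trans; exact: expR_ge0.
have exp_ge x : kappa * x <= expR (kappa * x) by apply: le_trans (expR_ge1Dx _); rewrite lerDr.
have posL s y : Num.max y 0 <= kappa^-1 * L s y.
  rewrite ge_max mulr_ge0 ?invr_ge0 ?(ltW k0) // andbT ler_pdivlMl //.
  by have /andP[+ _] := Lexp s y; apply: le_trans; exact: exp_ge.
have VL s y : V s y <= kappa^-1 * L s y.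
  apply: env_le => n; apply: (viter_least (f := fun s y => kappa^-1 * L s y)) => [t x|t a x aE].
    apply: le_trans (posL t x); rewrite /stop; case: ifP => _; rewrite le_max ?lexx //.
    by rewrite oppr_le0 loss_ge0 orbT.
  have := @step_affine R S Act M L t a x kappa^-1 0 aE; rewrite addr0 => H.
  have -> : step M (fun t x => kappa^-1 * L t x) t a x = kappa^-1 * step M L t a x.
    by rewrite -H; apply: eq_bigr => u _; rewrite addr0.
  by rewrite ler_wpM2l ?invr_ge0 ?(ltW k0) // LS.
exists L; split=> //; first by exists kappa^-1.
move=> e e0; pose K := kappa^-1 * C; have K0 : 0 < K by rewrite mulr_gt0 ?invr_gt0.
have V0 s : V s 0 <= K.
  apply: le_trans (VL s 0) _; rewrite ler_wpM2l ?invr_ge0 ?(ltW k0) //.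
  by have /andP[_] := Lexp s 0; rewrite mulr0 expR0 mulr1.
(* For negative y, [expR z >= z] and the second summand give [K * expR (kappa * y) <= e]. For
   positive y, [L >= (kappa * y / 2) ^+ 2] and the third give [e * L >= 2 * y], and the first gives
   [2 * y >= y + K]. *)
pose x := K + K / (e * kappa) + 8 / (e * kappa ^+ 2).
have ek0 : 0 < e * kappa by rewrite mulr_gt0.
have ekk0 : 0 < e * kappa ^+ 2 by rewrite mulr_gt0 // exprn_gt0.
have Kek0 : 0 < K / (e * kappa) by rewrite divr_gt0.
have ekk8 : 0 < 8 / (e * kappa ^+ 2) by rewrite divr_gt0.
exists x => s y; have [y0|y0] := lerP 0 y => xy.
  have yK : y <= e * L s y - K.
    have expL : (kappa * y / 2) ^+ 2 <= L s y.
      have /andP[+ _] := Lexp s y; apply: le_trans.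
      have -> : kappa * y = kappa * y / 2 + kappa * y / 2 by lra.
      have ky0 : 0 <= kappa * y / 2 by rewrite divr_ge0 // mulr_ge0 // ltW.
      rewrite expRD -expr2 -splitr lerXn2r ?nnegrE ?expR_ge0 //.
      by apply: le_trans (expR_ge1Dx _); rewrite lerDr.
    have yx : x <= y by rewrite ger0_norm in xy.
    have y8 : 8 <= y * (e * kappa ^+ 2).
      by rewrite -ler_pdivrMr //; move: yx; rewrite /x; lra.
    have yK : K <= y by move: yx; rewrite /x; lra.
    have e2 : y * 8 <= y * (y * (e * kappa ^+ 2)) by rewrite ler_wpM2l.
    have e3 := ler_wpM2l (ltW e0) expL.
    have e4 : e * (kappa * y / 2) ^+ 2 = y * (y * (e * kappa ^+ 2)) / 4 by field.
    lra.
  have /andP[_] := value_shift goal_absorbing CE_le_theta s 0 y0.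
  by rewrite add0r => /le_trans-> //; have := V0 s; lra.
apply: le_trans (VL s y) _.
apply: le_trans (_ : e <= _); last by rewrite mulrDr mulr1 lerDr mulr_ge0 // ltW.
apply: le_trans (_ : K * expR (kappa * y) <= _).
  rewrite /K -mulrA ler_wpM2l ?invr_ge0 ?(ltW k0) //.
  by have /andP[] := Lexp s y.
rewrite -[y]opprK mulrN expRN ler_pdivrMr ?expR_gt0 //.
apply: le_trans (_ : e * (kappa * - y) <= _); last by rewrite ler_wpM2l ?(ltW e0).
rewrite mulrA mulrC -ler_pdivrMr //; move: xy; rewrite ltr0_norm // /x; lra.
Qed.

End Lyapunov.

(** * Mass off the goal, and upper bounds for conditional expectations *)

Section Leak.
Variables (R : realType) (S Act : finType) (M : mdp S Act) (goal : S).
Hypothesis goal_absorbing : absorbing M goal.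
Variables (sigma : scheduler R M) (theta : R).
Implicit Types (s t : S) (a : Act) (x y z : R) (n : nat) (p : fin_path S Act).

Definition off_goal (J : S -> R -> R) s y : R := if s == goal then 0 else J s y.

(* A J-fraction of the mass off the goal moves to the goal within m steps, and
   the total mass (weighted by f) arriving at the goal is bounded. *)
Lemma ev_off_goal m (f : R -> R) (J : S -> R -> R) : (forall y, 0 <= f y) ->
  (forall p, is_path M p -> last_st p != goal ->
    at_ M theta J p <= ev sigma m (at_ M theta (on_goal goal f)) p) ->
  (exists k, forall n, goal_ev goal sigma theta n f <= k) ->
  forall e, 0 < e -> exists N, forall n, (N <= n)%N ->
    ev sigma n (at_ M theta (off_goal J)) (init M, [::]) <= e.
Proof.
move=> f0 Jf [k fk] e e0; pose u n := goal_ev goal sigma theta n f.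
have us : has_sup (range u).
  by split; [exists (u 0%N), 0%N|exists k => _ [n _ <-]; exact: fk].
have [_ [N _ <-] uN] := sup_adherent e0 us; exists N => n Nn.
have u1 : u (n + m)%N <= sup (range u).
  by apply: ub_le_sup; [case: us|exists (n + m)%N].
have u2 : u N <= u n by exact: goal_ev_nd.
have : 1 * u n + 1 * ev sigma n (at_ M theta (off_goal J)) (init M, [::]) <= u (n + m)%N.
  rewrite /u /goal_ev ev_add -ev_lin; apply: le_ev => // p pP _.
  rewrite !mul1r {1 2}/at_ {1}/on_goal /off_goal.
  have [pg|pg] := eqVneq (last_st p) goal; last by rewrite add0r; exact: Jf.
  have := @le_ev_on_goal R S Act M sigma theta goal goal_absorbing 0 m f p pP f0 (leq0n m).
  by rewrite {1}/ev {1}/at_ {1}/on_goal pg eqxx addr0.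
rewrite !mul1r; move: uN u1 u2; rewrite /u; lra.
Qed.

Local Notation forced := (forced M goal).
Local Notation wmax := (wmax R M).
Local Notation pmin := (pmin R M).

Lemma negp_wt_ge y s a : negp y - wmax <= negp (y + weight R M s a).
Proof.
have w := wt_le R M s a; rewrite lerBlDr; apply: negp_le.
  have := negp_geN (y + weight R M s a); lra.
by rewrite addr_ge0 ?negp_ge0 ?wmax_ge0.
Qed.

(** Following [forced_succ], the goal, which is the only state of rank 1, is reached within j steps
    with probability at least [pmin ^+ j]. The summand [j%:R * wmax] makes up for the negative part
    shrinking by at most [wmax] per step. *)
Lemma forced_soon k j p : 0 <= k -> is_path M p -> last_st p \in forced ->
  (rank M goal (last_st p) <= j.+1)%N ->
  pmin ^+ j * (negp (excess M theta p) + k) <=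
  ev sigma j (at_ M theta (on_goal goal (fun y => negp y + k + j%:R * wmax))) p.
Proof.
move=> k0; have w0 := wmax_ge0 R M; have /andP[p0 p1] := pmin_itv R M.
elim: j k k0 p => [|j IH] k k0 p pP pF rp.
  have pg : last_st p == goal.
    apply: contraLR rp => pg.
    have [t [tF _ tr]] := forced_succ pF pg (some_act_enabled M _).
    by rewrite -ltnNge (leq_ltn_trans _ tr) // fix_order_gt0.
  by rewrite /ev /at_ /on_goal pg expr0 mul1r mul0r addr0.
have f0 y : 0 <= negp y + k + j.+1%:R * wmax.
  by rewrite !addr_ge0 ?negp_ge0 // mulr_ge0.
have [pg|pg] := eqVneq (last_st p) goal.
  have := @le_ev_on_goal R S Act M sigma theta goal goal_absorbing 0 j.+1 _ p pP f0 (leq0n _).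
  apply: le_trans; rewrite /ev /at_ /on_goal pg eqxx.
  apply: le_trans (_ : negp (excess M theta p) + k <= _).
    by rewrite ler_piMl ?addr_ge0 ?negp_ge0 // exprn_ile1 // ltW.
  by rewrite lerDl mulr_ge0.
rewrite -[X in ev _ X]addn1 addnC ev_add; apply: ev1_ge => // a aE.
have [t [tF pt tr]] := forced_succ pF pg aE.
rewrite (bigD1 t) //= -[leLHS]addr0 lerD //; last first.
  apply: sumr_ge0 => u _; have := prob_ge0 R M (last_st p) a u.
  rewrite le_eqVlt prob_gt0 => /predU1P[<-|u0]; first by rewrite mul0r.
  rewrite mulr_ge0 ?prob_ge0 //.
  rewrite -(@ev_cst R S Act M sigma j 0 (extend p (a, u))) ?is_path_extend ?pP //.
  apply: le_ev => [|q _ _]; first by rewrite is_path_extend pP.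
  by rewrite /at_ /on_goal; case: ifP.
have eP : is_path M (extend p (a, t)) by rewrite is_path_extend pP.
rewrite exprS -mulrA; apply: ler_pM => //; first exact: ltW.
- by rewrite mulr_ge0 ?addr_ge0 ?negp_ge0 // exprn_ge0 // ltW.
- exact: pmin_le.
have := IH (k + wmax) _ (extend p (a, t)) eP; rewrite last_extend.
move=> /(_ _ tF) H; apply: le_trans (le_trans (H _ _) _); rewrite ?addr_ge0 //.
- rewrite ler_wpM2l ?exprn_ge0 ?(ltW p0) //.
  rewrite [excess _ _ (extend _ _)]/excess wgt_extend rmorphD /= addrAC.
  by have := negp_wt_ge (excess M theta p) (last_st p) a; rewrite /weight /excess; lra.
- by rewrite -ltnS; exact: leq_trans tr rp.
apply: le_ev => // q _ _; rewrite /at_ /on_goal; case: ifP => // _.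
by rewrite mulrS; lra.
Qed.

End Leak.

Section Verification.
Variables (R : realType) (S Act : finType) (M : mdp S Act) (goal : S).
Hypothesis goal_absorbing : absorbing M goal.
Variable theta : R.
Implicit Types (s t : S) (a : Act) (y : R) (n : nat).

(* U majorizes W - theta + delta.  Off the goal it may be negative only at forced
   states, whose share of the expectation vanishes by [ev_off_goal]. *)
Lemma CE_le_superharmonic (U : S -> R -> R) (delta k : R) (sigma : scheduler R M) :
  (forall s a (w : int), a \in enabled M s ->
    step M U s a (w%:~R - theta) <= U s (w%:~R - theta)) ->
  (forall y, y + delta <= U goal y) ->
  (forall s y, s \notin forced M goal -> 0 <= U s y) ->
  0 <= k -> (forall s y, - (negp y + k) <= U s y) ->
  U (init M) (- theta) <= 0 ->
  (0 < Pr sigma (init M) (reach M goal))%E ->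
  (CE goal sigma <= (theta - delta)%:E)%E.
Proof.
move=> US Ug Us k0 Uk Ui p0; apply: CE_le => // -[K nK] e e0.
have /andP[q0 _] := pmin_itv R M; have w0 := wmax_ge0 R M.
pose q := pmin R M ^+ #|S|; have {}q0 : 0 < q by rewrite exprn_gt0.
pose f y := negp y + k + #|S|%:R * wmax R M.
have shiftE n g : goal_ev goal sigma (theta - delta) n g =
    goal_ev goal sigma theta n (fun y => g (y + delta)).
  apply: eq_ev => p; rewrite /at_ /on_goal /excess; case: ifP => // _.
  by congr g; lra.
(* [q] times the largest deficit that U may have at a forced state; by [forced_soon] this much
   arrives at the goal within [#|S|] steps. *)
pose J s y := if s \in forced M goal then q * (negp y + k) else 0.
have f0 y : 0 <= f y by rewrite !addr_ge0 ?negp_ge0 // mulr_ge0.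
have [||N NP] := @ev_off_goal R S Act M goal goal_absorbing sigma theta #|S| f J f0 _ _
  (q * e) (mulr_gt0 q0 e0).
- move=> p pP pg; rewrite {1}/at_ /J; case: ifP => pF.
    by apply: forced_soon => //; rewrite (leq_trans (fix_order_le_max _ _)).
  rewrite -(@ev_cst R S Act M sigma #|S| 0 p) //; apply: le_ev => // r _ _.
  by rewrite /at_ /on_goal; case: ifP.
- exists (K + (`|delta| + k + #|S|%:R * wmax R M)) => n.
  have := nK n; rewrite shiftE => nKn.
  apply: le_trans (_ : goal_ev goal sigma theta n
    (fun y => 1 * negp (y + delta) + (`|delta| + k + #|S|%:R * wmax R M) * 1) <= _).
    apply: goal_ev_le => y; rewrite mul1r mulr1 /f !addrA !lerD2r; apply: negp_le.
      by have := negp_geN (y + delta); have := ler_norm delta; lra.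
    by rewrite addr_ge0 ?negp_ge0.
  rewrite goal_ev_lin mul1r lerD // ler_piMr //; last by case/andP: (goal_ev1 goal sigma theta n).
  by rewrite !addr_ge0 // mulr_ge0.
exists N => n Nn; rewrite shiftE.
apply: le_trans (_ : ev sigma n (fun p => 1 * at_ M theta U p +
  q^-1 * at_ M theta (off_goal goal J) p) (init M, [::]) <= _).
  apply: le_ev => // p _ _; rewrite mul1r /at_ /on_goal /off_goal /J.
  have [->|pg] := eqVneq (last_st p) goal; first by rewrite mulr0 addr0.
  case: (boolP (_ \in _)) => pF; last by rewrite mulr0 addr0 Us.
  by rewrite mulrA mulVf ?gt_eqF // mul1r addrC -lerBlDl sub0r.
rewrite ev_lin mul1r -[leRHS]add0r lerD //.
  have i0P : is_path M (init M, [::]) by [].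
  apply: le_trans (ev_superharmonic sigma n i0P US) _.
  by rewrite /at_ /excess /path_wgt /= sub0r.
by rewrite ler_pdivrMl // NP.
Qed.

End Verification.

(** * Conserving actions and the optimal scheduler *)

Section Optimal.
Variables (R : realType) (S Act : finType) (M : mdp S Act) (goal : S).
Hypothesis goal_absorbing : absorbing M goal.
Hypothesis fail_unique : fail_collapsed M goal.
Variable theta : R.
Hypothesis CE_le_theta : forall sigma : scheduler R M,
  (0 < Pr sigma (init M) (reach M goal))%E -> (CE goal sigma <= theta%:E)%E.
Implicit Types (s t : S) (a : Act) (x y z : R) (n m : nat) (w : int).

Local Notation V := (@value R S Act M goal).
Local Notation wt := (@weight R S Act M).
Local Notation forced := (forced M goal).

Let V_super := value_super goal_absorbing CE_le_theta.
Let V_safe := value_safe goal_absorbing CE_le_theta.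
Let V_goal := value_goal goal_absorbing CE_le_theta.

Definition conserving s a y := a \in enabled M s /\ step M V s a y = V s y.

Fixpoint reaches n s y : Prop :=
  if n is n'.+1 then
    exists a, conserving s a y /\ exists t, 0 < tr M s a t /\ reaches n' t (y + wt s a)
  else s = goal.

Definition stuck s y := forall n, ~ reaches n s y.

Lemma stuck_succ s a y t : stuck s y -> conserving s a y -> 0 < tr M s a t ->
  stuck t (y + wt s a).
Proof. by move=> sS aC pt n tn; apply: (sS n.+1); exists a; split=> //; exists t. Qed.

(** Some action conserves V, and at a forced state every action has a forced successor of smaller
    rank; iterating gives a conserving path to the goal. *)
Lemma stuck_safe s y : stuck s y -> s \notin forced.
Proof.
move=> sS; apply/negP => sF; have [n] := ubnP (rank M goal s).
elim: n s y sS sF => // n IH s y sS sF rn.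
have sg : s != goal by apply/eqP => sg; exact: (sS 0%N).
have [a aE aV] := value_conserving goal_absorbing CE_le_theta s y.
have [t [tF pt tr]] := forced_succ sF sg aE.
by apply: (IH t (y + wt s a)) => //; [exact: stuck_succ pt|exact: leq_trans tr rn].
Qed.

Lemma latticeS s a w : w%:~R - theta + wt s a = (w + wgt M s a)%:~R - theta.
Proof. by rewrite rmorphD addrAC. Qed.

Lemma lattice_finite x : exists N (d : 'I_N -> int),
  forall w, `|w%:~R - theta| <= x -> exists i, w = d i.
Proof.
pose N := (Num.bound (`|x| + `|theta|)).
exists (N + N)%N, (fun i => i%:Z - N%:Z) => w wx.
have /andP[w1 w2] : - N%:Z <= w < N%:Z.
  have : `|w%:~R| < N%:R :> R.
    apply: le_lt_trans (_ : `|x| + `|theta| < _); last first.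
      by apply: le_lt_trans (archi_boundP _); rewrite ?addr_ge0 // ler_norm.
    rewrite -[w%:~R](subrK theta); apply: le_trans (ler_normD _ _) _.
    by rewrite lerD2r; apply: le_trans wx (ler_norm _).
  rewrite ltr_norml => /andP[h1 h2]; apply/andP; split.
    by rewrite -(ler_int R) rmorphN; exact: ltW.
  by rewrite -(ltr_int R).
have wN : (absz (w + N%:Z)%R < N + N)%N by lia.
by exists (Ordinal wN) => /=; lia.
Qed.

(** Integrality of the weights is used here: a bounded window contains finitely many of them, so the
    positive losses have a positive minimum. *)
Lemma conserving_gap x : exists delta, 0 < delta /\ forall s a w,
  `|w%:~R - theta| <= x -> a \in enabled M s -> ~ conserving s a (w%:~R - theta) ->
  step M V s a (w%:~R - theta) <= V s (w%:~R - theta) - delta.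
Proof.
have [N [d dP]] := lattice_finite x.
pose D (u : S * Act * 'I_N) : R := let y := (d u.2)%:~R - theta in
  V u.1.1 y - step M V u.1.1 u.1.2 y.
exists (\big[Num.min/1]_(u | 0 < D u) D u); split; first exact: lt_bigmin.
move=> s a w /dP[i ->] aE nC; rewrite lerBrDl -lerBrDr.
apply: (bigmin_le_cond 1 D (j := ((s, a), i))).
rewrite /D /= subr_gt0 lt_neqAle V_super // andbT.
by apply/eqP => E; apply: nC.
Qed.

(* On stuck states, the value iteration stays below (1 - rho) V + rho e (L + 1)
   with rho > 0: reaching the goal takes a non-conserving action, which costs at
   least delta where |y| < x, and V <= e (L + 1) where |y| >= x. *)
Lemma stuck_le0 s w : stuck s (w%:~R - theta) -> V s (w%:~R - theta) <= 0.
Proof.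
have [L [LS L0 _ VL]] := value_lyapunov goal_absorbing fail_unique CE_le_theta.
move=> sS; apply/ler_addgt0Pr => e' e'0; rewrite add0r.
have [e [e0 <-]] : exists e, 0 < e /\ e * (L s (w%:~R - theta) + 1) = e'.
  have H : 0 < L s (w%:~R - theta) + 1 by rewrite ltr_wpDl.
  by exists (e' / (L s (w%:~R - theta) + 1)); rewrite divr_gt0 // divfK // gt_eqF.
have [x xP] := VL e e0; have [delta [d0 gap]] := conserving_gap x.
pose K := 1 + \sum_s `|V s x|; have K0 : 0 < K by rewrite ltr_pwDl // sumr_ge0.
have VK t y : y <= x -> V t y <= K.
  move=> yx; apply: le_trans (le_value goal_absorbing CE_le_theta t yx) _.
  rewrite /K (bigD1 t) //=; have := ler_norm (V t x).
  have : 0 <= \sum_(i | i != t) `|V i x| by exact: sumr_ge0.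
  lra.
(* Chosen so that [rho * K <= delta]: the loss of a non-conserving action pays for shrinking V by
   the factor [1 - rho]. Conversely [V <= (1 - rho) * V + rho * T] gives [V <= T], since
   [rho > 0]. *)
pose rho := delta / (K + delta); have Kd : 0 < K + delta by rewrite addr_gt0.
have r0 : 0 < rho by rewrite divr_gt0.
have r1 : rho <= 1 by rewrite ler_pdivrMr // mul1r lerDr ltW.
have rK : rho * K <= delta.
  by rewrite /rho mulrAC ler_pdivrMr // ler_wpM2l ?(ltW d0) // lerDl ltW.
pose T t y := e * (L t y + 1).
have T0 t y : 0 <= T t y by rewrite mulr_ge0 ?addr_ge0 ?(ltW e0).
suff H n t (z : int) : stuck t (z%:~R - theta) -> viter M (stop M goal) n t (z%:~R - theta) <=
    (1 - rho) * V t (z%:~R - theta) + rho * T t (z%:~R - theta).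
  have : V s (w%:~R - theta) <= (1 - rho) * V s (w%:~R - theta) + rho * T s (w%:~R - theta).
    by apply: env_le => n; exact: H.
  rewrite -subr_ge0 => H1; rewrite -subr_ge0 -/(T _ _) -(pmulr_rge0 _ r0).
  by apply: le_trans H1 _; lra.
elim: n t z => [|n IH] t z tS; set y := z%:~R - theta in tS *;
  have tV := V_safe y (stuck_safe tS); have ts := stop_safe y (stuck_safe tS);
  have rhs0 : 0 <= (1 - rho) * V t y + rho * T t y
    by rewrite addr_ge0 // mulr_ge0 ?T0 ?subr_ge0 ?(ltW r0).
  by rewrite /viter ts.
have [xy|yx] := lerP x `|y|.
  apply: le_trans (viter_le_env (viter_stop_bounded goal_absorbing CE_le_theta) _ _ _) _.
  rewrite -/V -[leLHS]mul1r -{1}(subrK rho 1) mulrDl lerD2l ler_wpM2l ?(ltW r0) //.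
  exact: xP.
rewrite viterS ge_max ts rhs0 /=; apply: best_le => a aE.
have [aC|aC] := pselect (conserving t a y).
  apply: le_trans (_ : step M (fun u v =>
    (1 - rho) * V u v + (rho * e * L u v + rho * e)) t a y <= _).
    apply: le_step => u pu; rewrite /y latticeS.
    apply: le_trans (IH u _ _) _; first by rewrite -latticeS; exact: stuck_succ pu.
    by rewrite /T; lra.
  rewrite (stepD _ (fun u v => (1 - rho) * V u v) (fun u v => rho * e * L u v + rho * e)).
  have -> : step M (fun u v => (1 - rho) * V u v) t a y = (1 - rho) * step M V t a y.
    by rewrite -[RHS]addr0 -(step_affine _ _ _ _ aE); apply: eq_bigr => u _; rewrite addr0.
  rewrite aC.2 lerD2l (step_affine _ _ _ _ aE) /T mulrA mulrDr mulr1 lerD2r.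
  by apply: ler_wpM2l; [rewrite mulr_ge0 ?(ltW r0) ?(ltW e0)|exact: LS].
apply: le_trans (_ : step M V t a y <= _).
  apply: le_step => u _.
  exact: viter_le_env (viter_stop_bounded goal_absorbing CE_le_theta) _ _ _.
apply: le_trans (gap t a z _ aE aC) _; first exact: ltW.
have : rho * V t y <= rho * K.
  by rewrite ler_wpM2l ?(ltW r0) // VK // (le_trans (ler_norm _)) // ltW.
have := mulr_ge0 (ltW r0) (T0 t y); rewrite -/y; lra.
Qed.

Lemma stuck_eq0 s w : stuck s (w%:~R - theta) -> V s (w%:~R - theta) = 0.
Proof.
move=> sS; apply/le_anti; rewrite stuck_le0 //=.
exact: V_safe (stuck_safe sS).
Qed.

(* Stuck states have value 0, hence bounded weights, and [step V] is
   nondecreasing in the weight. *)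
Lemma stuck_gap : exists delta, 0 < delta /\ forall s a w,
  stuck s (w%:~R - theta) -> a \in enabled M s -> ~ conserving s a (w%:~R - theta) ->
  step M V s a (w%:~R - theta) <= - delta.
Proof.
pose W s a w := [/\ stuck s (w%:~R - theta), a \in enabled M s &
  ~ conserving s a (w%:~R - theta)].
suff H (u : S * Act) : exists delta, 0 < delta /\ forall w, W u.1 u.2 w ->
    step M V u.1 u.2 (w%:~R - theta) <= - delta.
  have /choice[D DP] := H.
  exists (\big[Num.min/1]_u D u); split; first by apply: lt_bigmin => // u _; case: (DP u).
  move=> s a w sS aE aC; have [_ /(_ w)] := DP (s, a).
  move=> /(_ (And3 sS aE aC)) /= /le_trans-> //.
  by rewrite lerN2 (bigmin_le 1 _ D).
case: u => s a /=; have [[w0 w0W]|nW] := pselect (exists w, W s a w); last first.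
  by exists 1; split=> // w wW; case: nW; exists w.
(* Otherwise s is absorbing and each of its enabled actions conserves V. *)
have rg : reachable M s goal.
  apply: contrapT => /negP nr; have sA := fail_unique.1 s nr.
  by case: w0W => _ aE []; split=> //; rewrite absorbing_step.
have [x xP] := value_infty goal_absorbing CE_le_theta 1 rg.
have WB w : W s a w -> w%:~R < x + theta :> R.
  move=> [sS _ _]; rewrite ltNge; apply/negP => xw.
  have := xP (w%:~R - theta); rewrite stuck_eq0 // lerBrDr => /(_ xw).
  by rewrite ler10.
pose P j := `[< W s a (w0 + Posz j) >].
have P0 : exists j, P j by exists 0%N; apply/asboolP; rewrite addr0.
pose J := Num.bound (`|x + theta - w0%:~R|).
have PJ j : P j -> (j <= J)%N.
  move=> /asboolP/WB; rewrite rmorphD /= => jx; rewrite -(ler_nat R).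
  apply: le_trans (ltW (archi_boundP (normr_ge0 _))).
  by apply: le_trans (ler_norm _); rewrite -pmulrn in jx *; lra.
(* The weights are not bounded below, so [conserving_gap] does not suffice; by monotonicity the loss
   at the greatest weight bounds all the others. *)
case: (ex_maxnP P0 PJ) => j /asboolP[jS _ jC] jmax.
exists (- step M V s a ((w0 + Posz j)%:~R - theta)); split.
  rewrite oppr_gt0 -(stuck_eq0 jS) lt_neqAle V_super; last by case: w0W.
  by rewrite andbT; apply/eqP => E; apply: jC; split=> //; case: w0W.
move=> w wW; rewrite opprK; apply: ler_sum => t _; apply: ler_wpM2l; first exact: prob_ge0.
apply: (le_value goal_absorbing CE_le_theta).
rewrite !lerD2r ler_int; have [ww0|ww0] := lerP w w0; first lia.
have wE : w = w0 + Posz (absz (w - w0)%R) by lia.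
have : P (absz (w - w0)%R) by apply/asboolP; rewrite -wE.
by move/jmax; lia.
Qed.

Hypothesis CE_sup_least : forall k, (forall sigma : scheduler R M,
  (0 < Pr sigma (init M) (reach M goal))%E -> (CE goal sigma <= k%:E)%E) -> theta <= k.

(** Were U nonpositive at the start, every conditional expectation would be at most [theta - delta],
    contradicting that theta is the least bound. *)
Lemma no_majorant (U : S -> R -> R) delta : 0 < delta ->
  (forall s a w, a \in enabled M s ->
    step M U s a (w%:~R - theta) <= U s (w%:~R - theta)) ->
  (forall y, y + delta <= U goal y) ->
  (forall s y, s \notin forced -> 0 <= U s y) ->
  (exists k, 0 <= k /\ forall s y, - (negp y + k) <= U s y) ->
  0 < U (init M) (- theta).
Proof.
move=> d0 US Ug Us [k [k0 Uk]]; rewrite ltNge; apply/negP => Ui.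
have : theta <= theta - delta.
  by apply: CE_sup_least => sigma; exact: (CE_le_superharmonic goal_absorbing US Ug Us k0 Uk Ui).
by lra.
Qed.

(** If V were negative at the start, V raised by the constant [- V (init M) (- theta)] would be a
    forbidden majorant, with that constant as [delta]. *)
Lemma value_init0 : V (init M) (- theta) = 0.
Proof.
apply/le_anti; rewrite value_init //= leNgt; apply/negP => V0.
have := @no_majorant (fun s y => 1 * V s y + - V (init M) (- theta)) (- V (init M) (- theta)).
rewrite oppr_gt0 mul1r subrr ltxx => H; apply: notF; apply: H => //.
- by move=> s a w aE; rewrite step_affine // lerD2r !mul1r V_super.
- by move=> y; rewrite mul1r V_goal.
- by move=> s y sF; rewrite mul1r addr_ge0 ?V_safe // oppr_ge0 ltW.
have [k [k0 kV]] := value_lower goal_absorbing CE_le_theta.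
by exists k; split=> // s y; have := kV s y; rewrite mul1r; lra.
Qed.

(* Otherwise U = 0 on stuck states and V + delta elsewhere contradicts
   [no_majorant]. *)
Lemma init_reaches : exists n, reaches n (init M) (- theta).
Proof.
apply: contrapT => /forallNP iS; have [delta [d0 gap]] := stuck_gap.
pose U s y := if `[< stuck s y >] then 0 else 1 * V s y + delta.
have U0 : U (init M) (- theta) = 0 by rewrite /U asboolT.
have := @no_majorant U delta d0; rewrite U0 ltxx => H; apply: notF; apply: H.
- have UV t w : U t (w%:~R - theta) <= 1 * V t (w%:~R - theta) + delta.
    by rewrite /U; case: asboolP => // tS; rewrite mul1r stuck_eq0 // add0r ltW.
  have UV1 s a w : step M U s a (w%:~R - theta) <=
      step M (fun t y => 1 * V t y + delta) s a (w%:~R - theta).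
    by apply: le_step => t _; rewrite latticeS.
  move=> s a w aE; rewrite {2}/U; case: asboolP => sS.
    have [aC|aC] := pselect (conserving s a (w%:~R - theta)).
      by apply: step_le_cst => // t pt; rewrite /U asboolT //; exact: stuck_succ pt.
    apply: le_trans (UV1 s a w) _; rewrite step_affine // mul1r.
    by have := gap s a w sS aE aC; lra.
  by apply: le_trans (UV1 s a w) _; rewrite step_affine // lerD2r !mul1r V_super.
- move=> y; have gS : ~ stuck goal y by move=> /(_ 0%N); apply.
  by rewrite /U asboolF // mul1r V_goal.
- move=> s y sF; rewrite /U; case: asboolP => // _.
  by rewrite mul1r addr_ge0 ?(ltW d0) //; exact: V_safe.
have [k [k0 kV]] := value_lower goal_absorbing CE_le_theta.
exists k; split=> // s y; rewrite /U; case: asboolP => _; last by have := kV s y; lra.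
by have := negp_ge0 y; lra.
Qed.

End Optimal.
Section OptimalScheduler.
Variables (R : realType) (S Act : finType) (M : mdp S Act) (goal : S).
Hypothesis goal_absorbing : absorbing M goal.
Hypothesis fail_unique : fail_collapsed M goal.
Variable theta : R.
Hypothesis CE_le_theta : forall sigma : scheduler R M,
  (0 < Pr sigma (init M) (reach M goal))%E -> (CE goal sigma <= theta%:E)%E.
Hypothesis CE_sup_least : forall k, (forall sigma : scheduler R M,
  (0 < Pr sigma (init M) (reach M goal))%E -> (CE goal sigma <= k%:E)%E) -> theta <= k.
Implicit Types (s t : S) (a : Act) (x y z : R) (n m : nat) (w : int).
Implicit Types (p : fin_path S Act).

Local Notation V := (@value R S Act M goal).
Local Notation wt := (@weight R S Act M).
Local Notation conserving := (conserving M goal).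
Local Notation reaches := (reaches M goal).

(** A conserving action that begins a shortest conserving path to the goal, if there is one. Its
    dependence on state and excess alone makes the scheduler weight-based. *)
Lemma progress_act (u : S * R) : exists a, conserving u.1 a u.2 /\
  forall n, reaches n.+1 u.1 u.2 -> (forall k, (k <= n)%N -> ~ reaches k u.1 u.2) ->
    exists t, 0 < tr M u.1 a t /\ reaches n t (u.2 + wt u.1 a).
Proof.
case: u => s y /=; have [b bE bV] := value_conserving goal_absorbing CE_le_theta s y.
have [[n [rn nmin]]|nr] := pselect (exists n, reaches n.+1 s y /\
  forall k, (k <= n)%N -> ~ reaches k s y); last first.
  by exists b; split=> // n rn nmin; case: nr; exists n.
have [a [aC at_]] := rn; exists a; split=> // m rm mmin.
suff -> : m = n by [].
apply/eqP; rewrite eqn_leq; apply/andP; split; rewrite leqNgt; apply/negP => h.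
  exact: (mmin n.+1).
exact: (nmin m.+1).
Qed.

Let act : S * R -> Act := fun u => sval (cid (progress_act u)).

Let act_conserving s y : conserving s (act (s, y)) y.
Proof. by have [] := svalP (cid (progress_act (s, y))). Qed.

Let pol p : Act := act (last_st p, excess M theta p).

Let pol_enabled p : pol p \in enabled M (last_st p).
Proof. by have [] := act_conserving (last_st p) (excess M theta p). Qed.

Let sigma := det_scheduler R pol_enabled.

Let sigma_weight_based : weight_based sigma.
Proof.
move=> p q _ _ pq wpq; apply/funext => a /=.
by rewrite /pol /excess pq wpq.
Qed.

Let i0 : fin_path S Act := (init M, [::]).
Let i0P : is_path M i0. Proof. by []. Qed.

Let excess_i0 : excess M theta i0 = - theta.
Proof. by rewrite /excess /path_wgt /= sub0r. Qed.

Let ev_V n : ev sigma n (at_ M theta V) i0 = 0.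
Proof.
have V0 : at_ M theta V i0 = 0.
  by rewrite /at_ excess_i0 (value_init0 goal_absorbing CE_le_theta CE_sup_least).
have step1 q : ev sigma 1 (at_ M theta V) q = at_ M theta V q.
  by rewrite det_ev1 at_step; have [] := act_conserving (last_st q) (excess M theta q).
rewrite -V0; apply/le_anti/andP; split.
  by apply: ev_super => // q _ _; rewrite step1.
by apply: ev_sub => // q _ _; rewrite step1.
Qed.

Let ev_L (L : S -> R -> R) n : superharmonic M L ->
  ev sigma n (at_ M theta L) i0 <= L (init M) (- theta).
Proof.
move=> LS; apply: le_trans (ev_superharmonic sigma n i0P _) _ => [s a w aE|].
  exact: LS.
by rewrite /at_ excess_i0.
Qed.

Lemma ev_on_goal_ge0 m p : is_path M p ->
  0 <= ev sigma m (at_ M theta (on_goal goal (fun=> 1))) p.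
Proof.
move=> pP; rewrite -(ev_cst sigma m 0 pP); apply: le_ev => // q _ _.
by rewrite /at_ /on_goal; case: ifP.
Qed.

Let reach_soon n s y : reaches n s y -> exists kappa m, 0 < kappa /\
  forall p, is_path M p -> last_st p = s -> excess M theta p = y ->
    kappa <= ev sigma m (at_ M theta (on_goal goal (fun=> 1))) p.
Proof.
have [k] := ubnP n; elim: k n s y => // k IH [|n] s y nk.
  move=> /= sg; exists 1, 0%N; split=> // p _ ps _.
  by rewrite /ev /at_ /on_goal ps sg eqxx.
(* The chosen action makes progress only along shortest paths; a longer path is first replaced by a
   shorter one, hence the strong induction. *)
have [[j [jn rj]] _|nmin rn] := pselect (exists j, (j <= n)%N /\ reaches j s y).
  by apply: (IH j) rj; apply: leq_ltn_trans jn _.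
have [_ /(_ n rn)] := svalP (cid (progress_act (s, y))).
have nmin' j : (j <= n)%N -> ~ reaches j s y by move=> jn rj; apply: nmin; exists j.
move=> /(_ nmin')[t [pt rt]].
have [kappa [m [k0 km]]] := IH n _ _ nk rt.
exists (prob R M s (act (s, y)) t * kappa), m.+1; split.
  by rewrite mulr_gt0 // prob_gt0.
move=> p pP ps py; rewrite -[m.+1]add1n ev_add det_ev1 /pol ps py (bigD1 t) //=.
have eP u : 0 < tr M s (act (s, y)) u -> is_path M (extend p (act (s, y), u)).
  by move=> pu; rewrite is_path_extend pP ps.
rewrite -[leLHS]addr0 lerD //; last first.
  apply: sumr_ge0 => u _; have := prob_ge0 R M s (act (s, y)) u.
  rewrite le_eqVlt prob_gt0 => /predU1P[<-|u0]; first by rewrite mul0r.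
  by rewrite mulr_ge0 ?prob_ge0 // ev_on_goal_ge0 // eP.
rewrite ler_wpM2l ?prob_ge0 // km ?eP ?last_extend //.
by rewrite [LHS]/excess wgt_extend rmorphD addrAC -/(excess M theta p) py ps.
Qed.

Let reach_soon_unif x : exists kappa m, 0 < kappa /\
  forall p, is_path M p -> `|excess M theta p| <= x ->
    (exists n, reaches n (last_st p) (excess M theta p)) ->
    kappa <= ev sigma m (at_ M theta (on_goal goal (fun=> 1))) p.
Proof.
have [N [d dP]] := lattice_finite theta x.
have /choice[f fP] : forall u : S * 'I_N, exists km : R * nat, 0 < km.1 /\
    ((exists n, reaches n u.1 ((d u.2)%:~R - theta)) ->
     forall p, is_path M p -> last_st p = u.1 -> excess M theta p = (d u.2)%:~R - theta ->
     km.1 <= ev sigma km.2 (at_ M theta (on_goal goal (fun=> 1))) p).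
  move=> u; have [[n rn]|nr] := pselect (exists n, reaches n u.1 ((d u.2)%:~R - theta)).
    by have [kappa [m [k0 km]]] := reach_soon rn; exists (kappa, m).
  by exists (1, 0%N).
exists (\big[Num.min/1]_u (f u).1), (\max_u (f u).2)%N; split.
  by apply: lt_bigmin => // u _; case: (fP u).
move=> p pP px pr; have [i wi] := dP _ px.
have [_ H] := fP (last_st p, i); rewrite /= -wi in H.
apply: le_trans (bigmin_le 1 (last_st p, i) (fun u => (f u).1)) _.
apply: le_trans (H pr p pP erefl erefl) _.
apply: le_ev_on_goal => //; exact: (leq_bigmax (last_st p, i)).
Qed.

Let goal_ev_id n : goal_ev goal sigma theta n id =
  - ev sigma n (at_ M theta (off_goal goal V)) i0.
Proof.
have := ev_V n; have -> : ev sigma n (at_ M theta V) i0 =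
    ev sigma n (fun p => 1 * at_ M theta (on_goal goal id) p +
                        1 * at_ M theta (off_goal goal V) p) i0.
  apply: eq_ev => p; rewrite !mul1r /at_ /on_goal /off_goal.
  by case: eqP => [->|_]; rewrite ?add0r ?addr0 ?(value_goal goal_absorbing CE_le_theta).
by rewrite ev_lin !mul1r /goal_ev; lra.
Qed.

Let V_bound x s y : y <= x -> V s y <= 1 + \sum_s `|V s x|.
Proof.
move=> yx; apply: le_trans (le_value goal_absorbing CE_le_theta s yx) _.
rewrite (bigD1 s) //=; have := ler_norm (V s x).
have : 0 <= \sum_(i | i != s) `|V i x| by exact: sumr_ge0.
lra.
Qed.

(** The negative part is the positive part minus the reward. The positive part is dominated by L,
    and the expected reward is minus that of V off the goal, which is at most [L + 1 + K]. *)
Let neg_bounded : exists k, forall n, goal_ev goal sigma theta n negp <= k.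
Proof.
have [L [LS L0 [C LC] VL]] := value_lyapunov goal_absorbing fail_unique CE_le_theta.
have [x xP] := VL 1 ltr01; pose K := 1 + \sum_s `|V s x|.
have K0 : 0 <= K by rewrite addr_ge0 // sumr_ge0.
pose L1 := L (init M) (- theta).
have C0 : 0 <= C.
  rewrite leNgt; apply/negP => C0; have := LC goal 1; rewrite leNgt => /negP; apply.
  apply: le_lt_trans (_ : 0 < _); first by rewrite nmulr_rle0.
  by rewrite lt_max ltr01.
exists (C * L1 + (L1 + (1 + K))) => n.
apply: le_trans (_ : goal_ev goal sigma theta n (fun y => 1 * Num.max y 0 + -1 * y) <= _).
  apply: goal_ev_le => y; rewrite mul1r mulN1r; apply: negp_le.
    by rewrite lerDr le_max lexx orbT.
  by rewrite subr_ge0 le_max lexx.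
rewrite (goal_ev_lin goal sigma theta n (fun y => Num.max y 0) id) mul1r mulN1r.
rewrite goal_ev_id opprK lerD //.
  apply: le_trans (_ : ev sigma n (fun p => C * at_ M theta L p + 0 * 0) i0 <= _).
    apply: le_ev => // p _ _; rewrite mulr0 addr0 /at_ /on_goal; case: ifP => // _.
    by apply: le_trans (LC _ _); rewrite le_max lexx orbT.
  by rewrite (ev_lin sigma n (at_ M theta L) (fun=> 0)) mul0r addr0 ler_wpM2l // ev_L.
apply: le_trans (_ : ev sigma n (fun p => 1 * at_ M theta L p + (1 + K) * 1) i0 <= _).
  apply: le_ev => // p _ _; rewrite mul1r mulr1 /at_ /off_goal; case: ifP => _.
    by have := L0 (last_st p) (excess M theta p); lra.
  set y := excess _ _ _; have [xy|yx] := lerP x `|y|.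
    by apply: le_trans (xP _ _ xy) _; rewrite mul1r; have := L0 (last_st p) y; lra.
  have := @V_bound x (last_st p) y; rewrite -/K (le_trans (ler_norm y) (ltW yx)) => /(_ isT).
  by have := L0 (last_st p) y; lra.
by rewrite (ev_lin sigma n (at_ M theta L) (fun=> 1)) mul1r ev_cst // mulr1 lerD2r ev_L.
Qed.

Let off_goal_vanishes e : 0 < e -> exists N, forall n, (N <= n)%N ->
  ev sigma n (at_ M theta (off_goal goal V)) i0 <= e.
Proof.
move=> e0.
have [L [LS L0 _ VL]] := value_lyapunov goal_absorbing fail_unique CE_le_theta.
(* Half of [e] covers V outside the window, through [d * (L + 1)]. The other half covers the window,
   where [V <= K / kappa * J] at states with a conserving path and V vanishes at stuck ones. *)
pose L1 := L (init M) (- theta); have L10 : 0 < L1 + 1 by rewrite ltr_wpDl ?L0.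
pose d := e / 2 / (L1 + 1); have d0 : 0 < d by rewrite !divr_gt0.
have [x xP] := VL d d0; pose K := 1 + \sum_s `|V s x|.
have K0 : 0 < K by rewrite ltr_pwDl // sumr_ge0.
have [kappa [m [kappa0 km]]] := reach_soon_unif x.
pose J s y := if `[< `|y| <= x /\ exists n, reaches n s y >] then kappa else 0.
have [|||N NP] := @ev_off_goal R S Act M goal goal_absorbing sigma theta m (fun=> 1) J
  (fun=> ler01) _ _ (kappa * (e / 2) / K) _.
- move=> p pP _; rewrite {1}/at_ /J; case: asboolP => [[px pr]|_]; first exact: km.
  exact: ev_on_goal_ge0.
- by exists 1 => n; case/andP: (goal_ev1 goal sigma theta n).
- by rewrite divr_gt0 // mulr_gt0 // divr_gt0.
exists N => n Nn.
apply: le_trans (_ : ev sigma n (fun p => 1 * (d * at_ M theta L p + d * 1) +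
   K / kappa * at_ M theta (off_goal goal J) p) i0 <= _).
  apply: le_ev => // p _ _; rewrite mul1r mulr1 /at_ /off_goal.
  set s := last_st p; set y := excess _ _ _; case: eqP => _.
    by rewrite mulr0 addr0 addr_ge0 ?(ltW d0) //; exact: mulr_ge0 (ltW d0) (L0 _ _).
  have J0 : 0 <= K / kappa * J s y.
    by rewrite mulr_ge0 ?divr_ge0 ?(ltW K0) ?(ltW kappa0) // /J; case: ifP => // _; exact: ltW.
  have T0 : 0 <= d * L s y + d by exact: addr_ge0 (mulr_ge0 (ltW d0) (L0 _ _)) (ltW d0).
  have [xy|yx] := lerP x `|y|.
    by apply: le_trans (xP _ _ xy) _; rewrite mulrDr mulr1 lerDl.
  have [rs|nr] := pselect (exists n, reaches n s y).
    rewrite /J asboolT; last by split=> //; exact: ltW.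
    rewrite divfK ?gt_eqF //; apply: le_trans (_ : K <= _); last by rewrite lerDr.
    by apply: V_bound; exact: le_trans (ler_norm y) (ltW yx).
  rewrite (stuck_eq0 goal_absorbing fail_unique CE_le_theta); first by rewrite addr_ge0.
  by move=> k rk; apply: nr; exists k.
rewrite ev_lin mul1r (ev_lin sigma n (at_ M theta L) (fun=> 1)) ev_cst // -mulrDr.
have dE : d * (L1 + 1) = e / 2 by rewrite /d divfK // gt_eqF.
have h1 : d * (ev sigma n (at_ M theta L) i0 + 1) <= e / 2.
  by rewrite -dE ler_wpM2l ?(ltW d0) // lerD2r ev_L.
have h2 : K / kappa * ev sigma n (at_ M theta (off_goal goal J)) i0 <= e / 2.
  apply: le_trans (ler_wpM2l _ (NP n Nn)) _; first by rewrite divr_ge0 // ltW.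
  by rewrite le_eqVlt; apply/orP; left; apply/eqP; field; rewrite !gt_eqF.
by lra.
Qed.

Lemma optimal_scheduler : exists rho : scheduler R M,
  [/\ weight_based rho, deterministic rho,
      (0 < Pr rho (init M) (reach M goal))%E & CE goal rho = theta%:E].
Proof.
have p0 : (0 < Pr sigma (init M) (reach M goal))%E.
  have [n rn] := init_reaches goal_absorbing fail_unique CE_le_theta CE_sup_least.
  have [kappa [m [k0 km]]] := reach_soon rn.
  apply: (prob_reach_gt0 goal_absorbing (theta := theta) (n := m)).
  exact: lt_le_trans k0 (km i0 i0P erefl excess_i0).
exists sigma; split=> //; first exact: det_deterministic.
apply/le_anti; rewrite CE_le_theta //=.
have [|//] := CE_ge goal_absorbing neg_bounded p0 (lexx 0).
move=> e e0; have [N NP] := off_goal_vanishes e0; exists N => n Nn.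
by rewrite goal_ev_id sub0r lerN2 NP.
Qed.

End OptimalScheduler.

Theorem corollary16 (R : realType) (S Act : finType) (M : mdp S Act) (goal : S)
    (goal_absorbing : absorbing M goal)
    (fail_unique : fail_collapsed M goal)
    (CE_sup_finite : CE_sup R M goal \is a fin_num) :
  exists sigma : scheduler R M,
    [/\ weight_based sigma, deterministic sigma,
        (0 < Pr sigma (init M) (reach M goal))%E &
        CE goal sigma = CE_sup R M goal].
Proof.
rewrite -(fineK CE_sup_finite); apply: optimal_scheduler => // [sigma p0|k kP].
  by rewrite fineK //; apply: ereal_sup_ubound; exists sigma.
rewrite -lee_fin fineK //; apply: ge_ereal_sup => _ [sigma p0 <-]; exact: kP.
Qed.
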